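(* Let $\ell\in\{\tfrac12,\tfrac32,\tfrac52,\dots\}$ and $\delta,\mu\in\mathbb{R}$. If $2\delta-2(q-1)+\left(\ell+\tfrac12\right)^2=0$ for a positive integer $q$, then $$|u_{2q}\rangle=\left(\alpha_\ell\,\mu\,C-P_{\ell+\frac12}^2\right)^q|\delta,\mu\rangle\in V^{\delta,\mu}_{2q},\qquad \alpha_\ell=2\left(\left(\ell-\tfrac12\right)!\right)^2,$$ is a singular vector at level $2q$ of the Verma module $V^{\delta,\mu}$.
   Context: For $\ell\in\{\tfrac12,\tfrac32,\tfrac52,\dots\}$, $\mathfrak{g}_\ell$ is the complex Lie algebra (centrally extended conformal Galilei algebra) with basis $C,D,H,M,P_0,P_1,\dots,P_{2\ell}$, where $M$ is central and the other non-zero brackets are $[D,H]=2H$, $[D,C]=-2C$, $[C,H]=D$, $[H,P_n]=-nP_{n-1}$, $[D,P_n]=2(\ell-n)P_n$, $[C,P_n]=(2\ell-n)P_{n+1}$, $[P_m,P_n]=\delta_{m+n,2\ell}\,I_m M$ with $I_m=(-1)^{m+\ell+\frac12}\,m!\,(2\ell-m)!$. Triangular decomposition: $\mathfrak{g}_\ell^+=\mathrm{span}\{H,P_0,\dots,P_{\ell-\frac12}\}$, $\mathfrak{g}_\ell^0=\mathrm{span}\{D,M\}$, $\mathfrak{g}_\ell^-=\mathrm{span}\{C,P_{\ell+\frac12},\dots,P_{2\ell}\}$. For real $\delta,\mu$, the Verma module $V^{\delta,\mu}=U(\mathfrak{g}_\ell^-)|\delta,\mu\rangle$ is induced from the highest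 weight vector $|\delta,\mu\rangle$ with $D|\delta,\mu\rangle=\delta|\delta,\mu\rangle$, $M|\delta,\mu\rangle=\mu|\delta,\mu\rangle$, $\mathfrak{g}_\ell^+|\delta,\mu\rangle=0$. Its level-$m$ subspace $V^{\delta,\mu}_m$ (the $D$-eigenspace with eigenvalue $\delta-m$) has basis the vectors $C^h\prod_{j=0}^{\ell-\frac12}P_{\ell+\frac12+j}^{k_j}|\delta,\mu\rangle$ with $h,k_j\in\mathbb{Z}_{\ge0}$ and $2h+\sum_{j=0}^{\ell-\frac12}(2j+1)k_j=m$. A singular vector at level $m\ge1$ is a nonzero $u\in V^{\delta,\mu}_m$ with $Xu=0$ for all $X\in\mathfrak{g}_\ell^+$. *)

(* Defs.v *)
From HB Require Import structures.
From mathcomp Require Import all_boot all_order all_algebra.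
From mathcomp Require Import boolp reals.
From mathcomp Require Import complex.
From mathcomp Require Import monalg.

Set Implicit Arguments.
Unset Strict Implicit.
Unset Printing Implicit Defensive.

Import GRing.Theory Num.Theory.
Local Open Scope ring_scope.
Local Open Scope quotient_scope.
Local Open Scope complex_scope.

Section GeneratedIdeals.
Variables (A : pzRingType) (S : A -> Prop).

Inductive ideal_gen : A -> Prop :=
| ideal_gen_base a s b : S s -> ideal_gen (a * s * b)
| ideal_gen0 : ideal_gen 0
| ideal_genB x y : ideal_gen x -> ideal_gen y -> ideal_gen (x - y).

Inductive lideal_gen : A -> Prop :=
| lideal_gen_base a s : S s -> lideal_gen (a * s)
| lideal_gen0 : lideal_gen 0
| lideal_genB x y : lideal_gen x -> lideal_gen y -> lideal_gen (x - y).

Lemma ideal_genMl a x : ideal_gen x -> ideal_gen (a * x).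
Proof.
elim=> [b s c Ss||y z _ IHy _ IHz].
- by rewrite !mulrA; apply: ideal_gen_base.
- by rewrite mulr0; apply: ideal_gen0.
- by rewrite mulrBr; apply: ideal_genB.
Qed.

Lemma ideal_genMr a x : ideal_gen x -> ideal_gen (x * a).
Proof.
elim=> [b s c Ss||y z _ IHy _ IHz].
- by rewrite -mulrA; apply: ideal_gen_base.
- by rewrite mul0r; apply: ideal_gen0.
- by rewrite mulrBl; apply: ideal_genB.
Qed.

Lemma lideal_genMl a x : lideal_gen x -> lideal_gen (a * x).
Proof.
elim=> [b s Ss||y z _ IHy _ IHz].
- by rewrite mulrA; apply: lideal_gen_base.
- by rewrite mulr0; apply: lideal_gen0.
- by rewrite mulrBr; apply: lideal_genB.
Qed.

Definition ideal_pred : {pred A} := fun x => `[< ideal_gen x >].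
Definition lideal_pred : {pred A} := fun x => `[< lideal_gen x >].

Lemma ideal_pred_zmod : zmod_closed ideal_pred.
Proof.
split=> [|x y /asboolP Ix /asboolP Iy]; apply/asboolP; first exact: ideal_gen0.
exact: ideal_genB.
Qed.
HB.instance Definition _ := GRing.isZmodClosed.Build A ideal_pred ideal_pred_zmod.

Lemma lideal_pred_zmod : zmod_closed lideal_pred.
Proof.
split=> [|x y /asboolP Ix /asboolP Iy]; apply/asboolP; first exact: lideal_gen0.
exact: lideal_genB.
Qed.
HB.instance Definition _ :=
  GRing.isZmodClosed.Build A lideal_pred lideal_pred_zmod.

End GeneratedIdeals.

(* The quotient of a ring by the left ideal generated by S, as a left module. *)
Section LeftQuotient.
Variables (A : pzRingType) (S : A -> Prop).

Definition lquot := @Quotient.quot A (lideal_pred S).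
HB.instance Definition _ := GRing.Zmodule.on lquot.

Definition lquot_pi (a : A) : lquot := \pi_(Quotient.quot (lideal_pred S)) a.

Lemma lquot_piP a b : lquot_pi a = lquot_pi b <-> lideal_gen S (a - b).
Proof.
split=> [/eqP|Jab]; first by rewrite -Quotient.idealrBE => /asboolP.
by apply/eqP; rewrite -Quotient.idealrBE; apply/asboolP.
Qed.

Lemma lquot_piB : {morph lquot_pi : a b / a - b}.
Proof. by move=> a b; rewrite /lquot_pi !piE. Qed.

Lemma lquot_piD : {morph lquot_pi : a b / a + b}.
Proof. by move=> a b; rewrite /lquot_pi !piE. Qed.

Definition lquot_scale (a : A) (v : lquot) : lquot :=
  lquot_pi (a * repr (v : Quotient.quot (lideal_pred S))).

Lemma lquot_scale_pi a b : lquot_scale a (lquot_pi b) = lquot_pi (a * b).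
Proof.
apply/lquot_piP; rewrite -mulrBr; apply/lideal_genMl/lquot_piP.
by rewrite /lquot_pi reprK.
Qed.

Lemma lquot_ind (P : lquot -> Prop) : (forall a, P (lquot_pi a)) -> forall v, P v.
Proof.
by move=> Ppi v; have := Ppi (repr (v : Quotient.quot _)); rewrite /lquot_pi reprK.
Qed.

Lemma lquot_scaleA a b v :
  lquot_scale a (lquot_scale b v) = lquot_scale (a * b) v.
Proof. by elim/lquot_ind: v => c; rewrite !lquot_scale_pi mulrA. Qed.

Lemma lquot_scale1 : left_id 1 lquot_scale.
Proof. by elim/lquot_ind=> c; rewrite lquot_scale_pi mul1r. Qed.

Lemma lquot_scaleDr : right_distributive lquot_scale +%R.
Proof.
move=> a; elim/lquot_ind=> b; elim/lquot_ind=> c.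
by rewrite -lquot_piD !lquot_scale_pi mulrDr lquot_piD.
Qed.

Lemma lquot_scaleDl v : {morph lquot_scale^~ v : a b / a + b}.
Proof.
by move=> a b; elim/lquot_ind: v => c; rewrite !lquot_scale_pi mulrDl lquot_piD.
Qed.

HB.instance Definition _ := GRing.Zmodule_isLmodule.Build A lquot
  lquot_scaleA lquot_scale1 lquot_scaleDr lquot_scaleDl.

End LeftQuotient.

(* Universal enveloping algebra of the bilinear bracket br on the space
   {ffun B -> K^o} with basis B: the tensor algebra, i.e. the free algebra
   {malg K[{fmonom B}]} on B, modulo the relations x y - y x = [x, y]. *)
Section Enveloping.
Variables (K : fieldType) (B : finType).
Local Notation g := {ffun B -> K^o}.
Variable br : g -> g -> g.

Definition tensor_alg := {malg K[{fmonom B}]}.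
HB.instance Definition _ := GRing.Lalgebra.on tensor_alg.
Local Notation T := tensor_alg.

Lemma tensor_scaleAr (c : K) (x y : T) : c *: (x * y) = x * (c *: y).
Proof.
suff xc : x * c%:MP = c *: x.
  by rewrite scalerAl -xc -mulrA; congr (_ * _); apply: mul_malgC.
rewrite [LHS]fgmulgU [RHS]malgZ_def; apply: eq_bigr => k _.
by rewrite mulm1 mulrC.
Qed.
HB.instance Definition _ := GRing.Lalgebra_isAlgebra.Build K T tensor_scaleAr.

Definition tensor_inj (x : g) : T := \sum_b mkmalgU (fmu b) (x b).

Definition env_rel (f : T) : Prop := exists x y : g,
  f = tensor_inj x * tensor_inj y - tensor_inj y * tensor_inj x
      - tensor_inj (br x y).

Definition envelop := Quotient.quot (ideal_pred env_rel).
HB.instance Definition _ := GRing.Zmodule.on envelop.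

Definition env_pi (f : T) : envelop :=
  \pi_(Quotient.quot (ideal_pred env_rel)) f.

Lemma env_piP a b : env_pi a = env_pi b <-> ideal_gen env_rel (a - b).
Proof.
split=> [/eqP|Jab]; first by rewrite -Quotient.idealrBE => /asboolP.
by apply/eqP; rewrite -Quotient.idealrBE; apply/asboolP.
Qed.

Lemma env_piD : {morph env_pi : a b / a + b}.
Proof. by move=> a b; rewrite /env_pi !piE. Qed.

Lemma env_ind (P : envelop -> Prop) : (forall a, P (env_pi a)) -> forall v, P v.
Proof.
by move=> Ppi v; have := Ppi (repr (v : Quotient.quot _)); rewrite /env_pi reprK.
Qed.

Local Notation erepr v := (repr (v : Quotient.quot (ideal_pred env_rel))).

Lemma env_reprK v : env_pi (erepr v) = v.
Proof. by rewrite /env_pi reprK. Qed.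

Definition env_one : envelop := env_pi 1.
Definition env_mul (u v : envelop) : envelop := env_pi (erepr u * erepr v).
Definition env_scale (c : K) (u : envelop) : envelop := env_pi (c *: erepr u).

Lemma env_mul_pi a b : env_mul (env_pi a) (env_pi b) = env_pi (a * b).
Proof.
apply/env_piP; set a' := erepr _; set b' := erepr _.
have -> : a' * b' - a * b = (a' - a) * b' - a * (b - b').
  by rewrite mulrBl mulrBr opprB addrA subrK.
apply: ideal_genB; first by apply/ideal_genMr/env_piP; rewrite env_reprK.
by apply/ideal_genMl/env_piP; rewrite env_reprK.
Qed.

Lemma env_scale_pi c a : env_scale c (env_pi a) = env_pi (c *: a).
Proof.
apply/env_piP; rewrite -scalerBr -[_ - _]mul1r scalerAl.
by apply/ideal_genMl/env_piP; rewrite env_reprK.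
Qed.

Lemma env_mulA : associative env_mul.
Proof.
by do 3!elim/env_ind=> ?; rewrite !env_mul_pi mulrA.
Qed.

Lemma env_mul1 : left_id env_one env_mul.
Proof. by elim/env_ind=> a; rewrite env_mul_pi mul1r. Qed.

Lemma env_mulr1 : right_id env_one env_mul.
Proof. by elim/env_ind=> a; rewrite env_mul_pi mulr1. Qed.

Lemma env_mulDl : left_distributive env_mul +%R.
Proof.
by do 3!elim/env_ind=> ?; rewrite -env_piD !env_mul_pi mulrDl env_piD.
Qed.

Lemma env_mulDr : right_distributive env_mul +%R.
Proof.
by do 3!elim/env_ind=> ?; rewrite -env_piD !env_mul_pi mulrDr env_piD.
Qed.

HB.instance Definition _ := GRing.Zmodule_isPzRing.Build envelop
  env_mulA env_mul1 env_mulr1 env_mulDl env_mulDr.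

Lemma tensor_inj_coef1 x : mcoeff (@mone {fmonom B}) (tensor_inj x) = 0.
Proof.
rewrite raddf_sum big1 // => b _ /=; rewrite mcoeffU.
by case: eqP => // /(congr1 (@fmonom_val B)); rewrite fm1 fmU.
Qed.

Lemma coef1M (f h : T) : mcoeff (@mone {fmonom B}) (f * h) =
  mcoeff (@mone {fmonom B}) f * mcoeff (@mone {fmonom B}) h.
Proof. exact: (mcoeff1g_is_multiplicative {fmonom B} K).1. Qed.

Lemma env_rel_coef1 f : ideal_gen env_rel f -> mcoeff (@mone {fmonom B}) f = 0.
Proof.
have relP s : env_rel s -> mcoeff (@mone {fmonom B}) s = 0.
  move=> [x [y ->]]; rewrite !mcoeffB tensor_inj_coef1 subr0.
  have xy x' y' : mcoeff (@mone {fmonom B}) (tensor_inj x' * tensor_inj y') = 0.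
    by apply: etrans (coef1M _ _) _; rewrite tensor_inj_coef1 mul0r.
  by apply: etrans (congr2 (fun c d => c - d) (xy x y) (xy y x)) _; rewrite subrr.
elim=> [a s b /relP s0||x y _ Ix _ Iy].
- apply: etrans (coef1M _ _) _.
  suff -> : mcoeff (@mone {fmonom B}) (a * s) = 0 by rewrite mul0r.
  by apply: etrans (coef1M a s) _; rewrite s0 mulr0.
- exact: mcoeff0.
- by rewrite mcoeffB Ix Iy subrr.
Qed.

Lemma env_oner_neq0 : (1 : envelop) != 0.
Proof.
apply/eqP => e10; have: env_pi 1 = env_pi 0.
  by rewrite -[LHS]/(1 : envelop) e10 /env_pi raddf0.
move=> /env_piP; rewrite subr0 => /env_rel_coef1/eqP.
by rewrite rmorph1 oner_eq0.
Qed.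

HB.instance Definition _ :=
  GRing.PzSemiRing_isNonZero.Build envelop env_oner_neq0.

Lemma env_scaleA c d v :
  env_scale c (env_scale d v) = env_scale (c * d) v.
Proof. by elim/env_ind: v => a; rewrite !env_scale_pi scalerA. Qed.

Lemma env_scale1 : left_id 1 env_scale.
Proof. by elim/env_ind=> a; rewrite env_scale_pi scale1r. Qed.

Lemma env_scaleDr : right_distributive env_scale +%R.
Proof.
move=> c; do 2!elim/env_ind=> ?.
by rewrite -env_piD !env_scale_pi scalerDr env_piD.
Qed.

Lemma env_scaleDl v : {morph env_scale^~ v : c d / c + d}.
Proof.
by move=> c d; elim/env_ind: v => a; rewrite !env_scale_pi scalerDl env_piD.
Qed.

HB.instance Definition _ := GRing.Zmodule_isLmodule.Build K envelop
  env_scaleA env_scale1 env_scaleDr env_scaleDl.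

Lemma env_scaleAl (c : K) (u v : envelop) : c *: (u * v) = (c *: u) * v.
Proof.
elim/env_ind: u => a; elim/env_ind: v => b.
change (env_scale c (env_mul (env_pi a) (env_pi b)) =
        env_mul (env_scale c (env_pi a)) (env_pi b)).
by rewrite env_scale_pi !env_mul_pi env_scale_pi scalerAl.
Qed.

Lemma env_scaleAr (c : K) (u v : envelop) : c *: (u * v) = u * (c *: v).
Proof.
elim/env_ind: u => a; elim/env_ind: v => b.
change (env_scale c (env_mul (env_pi a) (env_pi b)) =
        env_mul (env_pi a) (env_scale c (env_pi b))).
by rewrite env_scale_pi !env_mul_pi env_scale_pi tensor_scaleAr.
Qed.

HB.instance Definition _ := GRing.Lmodule_isLalgebra.Build K envelop env_scaleAl.
HB.instance Definition _ := GRing.Lalgebra_isAlgebra.Build K envelop env_scaleAr.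

Definition env_inj (x : g) : envelop := env_pi (tensor_inj x).

Lemma env_inj_bracket x y :
  env_inj x * env_inj y - env_inj y * env_inj x = env_inj (br x y).
Proof.
have env_piB : {morph env_pi : a b / a - b} by move=> a b; rewrite /env_pi !piE.
apply: etrans (congr2 (fun u v => u - v) (env_mul_pi _ _) (env_mul_pi _ _)) _.
rewrite -env_piB; apply/env_piP.
set r := _ - _; suff -> : r = 1 * r * 1.
  by apply: ideal_gen_base; exists x, y.
by rewrite mul1r mulr1.
Qed.

End Enveloping.

(* Throughout, the natural number l encodes the half-integer
   ell = l + 1/2, so that 2 * ell = l.*2.+1 and ell - 1/2 = l. *)
Definition ell (F : fieldType) (l : nat) : F := l%:R + 2^-1.

Definition alpha_ell (F : fieldType) (l : nat) : F := 2 * (l`!)%:R ^+ 2.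

Inductive cga_gen (l : nat) : predArgType :=
  GenC | GenD | GenH | GenM | GenP of 'I_l.*2.+2.

Section GenFinType.
Variable l : nat.

Definition cga_gen_code (b : cga_gen l) : 'I_4 + 'I_l.*2.+2 :=
  match b with
  | GenC => inl (inord 0) | GenD => inl (inord 1)
  | GenH => inl (inord 2) | GenM => inl (inord 3)
  | GenP n => inr n
  end.

Definition cga_gen_decode (c : 'I_4 + 'I_l.*2.+2) : cga_gen l :=
  match c with
  | inr n => GenP n
  | inl i => nth (GenM l) [:: GenC l; GenD l; GenH l; GenM l] i
  end.

Lemma cga_gen_codeK : cancel cga_gen_code cga_gen_decode.
Proof. by case=> //=; rewrite inordK. Qed.

HB.instance Definition _ := Finite.copy (cga_gen l) (can_type cga_gen_codeK).

End GenFinType.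

Section ConformalGalilei.
Variables (K : fieldType) (l : nat).

Definition cga := {ffun cga_gen l -> K^o}.

Definition cga_basis (b : cga_gen l) : cga := [ffun b' => (b' == b)%:R].

Definition vC : cga := cga_basis (GenC l).
Definition vD : cga := cga_basis (GenD l).
Definition vH : cga := cga_basis (GenH l).
Definition vM : cga := cga_basis (GenM l).

(* P_n, extended by 0 for n > 2 ell. *)
Definition vP (n : nat) : cga :=
  [ffun b => if b is GenP i then (i == n :> nat)%:R else 0].

Definition cga_I (m : nat) : K :=
  (-1) ^+ (m + l.+1) * (m`!)%:R * ((l.*2.+1 - m)`!)%:R.

Definition cga_bracket_basis (a b : cga_gen l) : cga :=
  match a, b with
  | GenD, GenH => 2 *: vH
  | GenH, GenD => - (2 *: vH)
  | GenD, GenC => - (2 *: vC)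
  | GenC, GenD => 2 *: vC
  | GenC, GenH => vD
  | GenH, GenC => - vD
  | GenH, GenP n => - (n%:R *: vP n.-1)
  | GenP n, GenH => n%:R *: vP n.-1
  | GenD, GenP n => (2 * (ell K l - n%:R)) *: vP n
  | GenP n, GenD => - ((2 * (ell K l - n%:R)) *: vP n)
  | GenC, GenP n => (2 * ell K l - n%:R) *: vP n.+1
  | GenP n, GenC => - ((2 * ell K l - n%:R) *: vP n.+1)
  | GenP m, GenP n => if (m + n == l.*2.+1)%N then cga_I m *: vM else 0
  | _, _ => 0
  end.

Definition cga_bracket (x y : cga) : cga :=
  \sum_a \sum_b (x a * y b) *: cga_bracket_basis a b.

Definition cga_plus : {vspace cga} :=
  <<vH :: [seq vP j | j <- iota 0 l.+1]>>%VS.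

Definition Ucga := envelop cga_bracket.

Definition Uinj (x : cga) : Ucga := env_inj cga_bracket x.

(* The Verma module of highest weight (d, m) is U(g) (x)_{U(g^0 + g^+)} K,
   i.e. the quotient of U(g) by the left ideal generated by
   g^+, D - d and M - m; complex scalars act on it through c%:A. *)
Definition verma_rel (d m : K) (u : Ucga) : Prop :=
  [\/ exists2 x, x \in cga_plus & u = Uinj x,
      u = Uinj vD - d%:A | u = Uinj vM - m%:A].

Definition verma (d m : K) : lmodType Ucga := lquot (verma_rel d m).

Definition hwvec (d m : K) : verma d m := lquot_pi (verma_rel d m) 1.

Definition level (d m : K) (n : nat) (u : verma d m) : Prop :=
  Uinj vD *: u = (d - n%:R)%:A *: u.

Definition singular_vector (d m : K) (n : nat) (u : verma d m) : Prop :=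
  [/\ (0 < n)%N, u != 0, level n u
    & forall x, x \in cga_plus -> Uinj x *: u = 0].

End ConformalGalilei.

(* Main.v *)
(* Write X = alpha mu C - P_{l+1}^2 and v for the highest weight vector
   (l = ell - 1/2).  The constant alpha makes [P_l, X] a multiple of
   P_{l+1} (M - mu), and [P_k, X] is a multiple of P_{k+1} for k < l, so every
   X^q v is killed by P_0, ..., P_l; moreover [H, X] acts on X^j v by a scalar,
   and summing these scalars shows that H X^q v is a multiple of
   (2 delta - 2 (q - 1) + (ell + 1/2)^2) X^(q-1) v.
   To see X^q v <> 0 it is enough to find one representation with a highest
   weight vector w of weight (delta, mu) such that X^q w <> 0.  The subalgebra
   spanned by all generators but C acts on a Fock space, P_{l+1+j} creating
   and P_{l-j} annihilating the j-th boson; inducing to the whole algebra adds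
   one more boson c, on which C acts as creation.  There the coefficient of the
   (2q)-th power of the variable of P_{l+1} in X^q w comes from (- P_{l+1}^2)^q
   alone and does not vanish, whatever mu is. *)
From HB Require Import structures.
Require Import Defs.
From mathcomp Require Import all_boot all_order all_algebra.
From mathcomp Require Import boolp classical_sets functions reals.
From mathcomp Require Import complex.
From mathcomp Require Import monalg.
From mathcomp Require Import ring.

Set Implicit Arguments.
Unset Strict Implicit.
Unset Printing Implicit Defensive.

Import GRing.Theory Num.Theory.
Local Open Scope ring_scope.
Local Open Scope complex_scope.

(** * The algebra of linear endomorphisms of a function space *)

Section FunctionEndomorphisms.
Variables (K : fieldType) (T : pointedType).
Local Notation W := (T -> K^o).

(** Bundling map and linearity lets these operators form an algebra, the target of the Fock
    representation. Pointedness of [T] makes the function space non-zero, hence 1 different from 0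
    in this algebra. *)
Record endo := Endo { endo_fun :> W -> W; endo_linear : linear endo_fun }.

Lemma endoP (f g : endo) : (forall u, f u = g u) -> f = g.
Proof.
case: f g => [f lf] [g lg] /= /funext efg; case: _ / efg in lg *.
by congr Endo; exact: Prop_irrelevance.
Qed.

HB.instance Definition _ := gen_eqMixin endo.
HB.instance Definition _ := gen_choiceMixin endo.

Lemma endoD (f : endo) u v : f (u + v) = f u + f v.
Proof. by have := endo_linear f 1 u v; rewrite !scale1r. Qed.

Lemma endo0 (f : endo) : f 0 = 0.
Proof. by have /eqP := endoD f 0 0; rewrite addr0 -subr_eq subrr => /eqP. Qed.

Lemma endoZ (f : endo) c u : f (c *: u) = c *: f u.
Proof. by have := endo_linear f c u 0; rewrite endo0 !addr0. Qed.

Fact endo_zero_linear : linear (fun _ : W => 0 : W).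
Proof. by move=> c u v; rewrite scaler0 addr0. Qed.
Fact endo_add_linear (f g : endo) : linear (fun u => f u + g u).
Proof. by move=> c u v; rewrite !endoD !endoZ scalerDr addrACA. Qed.
Fact endo_opp_linear (f : endo) : linear (fun u => - f u).
Proof. by move=> c u v; rewrite endoD endoZ opprD scalerN. Qed.
Fact endo_one_linear : linear (fun u : W => u).
Proof. by []. Qed.
Fact endo_mul_linear (f g : endo) : linear (fun u => f (g u)).
Proof. by move=> c u v; rewrite !endoD !endoZ. Qed.
Fact endo_scale_linear (a : K) (f : endo) : linear (fun u => a *: f u).
Proof. by move=> c u v; rewrite endoD endoZ scalerDr !scalerA mulrC. Qed.

Definition endo_zero := Endo endo_zero_linear.
Definition endo_add f g := Endo (endo_add_linear f g).
Definition endo_opp f := Endo (endo_opp_linear f).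
Definition endo_one := Endo endo_one_linear.
Definition endo_mul f g := Endo (endo_mul_linear f g).
Definition endo_scale a f := Endo (endo_scale_linear a f).

Fact endo_addA : associative endo_add.
Proof. by move=> f g h; apply: endoP => u /=; rewrite addrA. Qed.
Fact endo_addC : commutative endo_add.
Proof. by move=> f g; apply: endoP => u /=; rewrite addrC. Qed.
Fact endo_add0 : left_id endo_zero endo_add.
Proof. by move=> f; apply: endoP => u /=; rewrite add0r. Qed.
Fact endo_addN : left_inverse endo_zero endo_opp endo_add.
Proof. by move=> f; apply: endoP => u /=; rewrite addNr. Qed.
HB.instance Definition _ :=
  GRing.isZmodule.Build endo endo_addA endo_addC endo_add0 endo_addN.

Fact endo_mulA : associative endo_mul.
Proof. by move=> f g h; apply: endoP. Qed.
Fact endo_mul1 : left_id endo_one endo_mul.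
Proof. by move=> f; apply: endoP. Qed.
Fact endo_mulr1 : right_id endo_one endo_mul.
Proof. by move=> f; apply: endoP. Qed.
Fact endo_mulDl : left_distributive endo_mul +%R.
Proof. by move=> f g h; apply: endoP. Qed.
Fact endo_mulDr : right_distributive endo_mul +%R.
Proof. by move=> f g h; apply: endoP => u /=; rewrite endoD. Qed.
Fact endo_one_neq0 : endo_one != 0.
Proof.
apply/eqP => /(congr1 (fun f : endo => f (fun=> 1) point)) /= /eqP.
by rewrite oner_eq0.
Qed.
HB.instance Definition _ := GRing.Zmodule_isNzRing.Build endo
  endo_mulA endo_mul1 endo_mulr1 endo_mulDl endo_mulDr endo_one_neq0.

Fact endo_scaleA a b f : endo_scale a (endo_scale b f) = endo_scale (a * b) f.
Proof. by apply: endoP => u /=; rewrite scalerA. Qed.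
Fact endo_scale1 : left_id 1 endo_scale.
Proof. by move=> f; apply: endoP => u /=; rewrite scale1r. Qed.
Fact endo_scaleDr : right_distributive endo_scale +%R.
Proof. by move=> a f g; apply: endoP => u /=; rewrite scalerDr. Qed.
Fact endo_scaleDl f : {morph endo_scale^~ f : a b / a + b}.
Proof. by move=> a b; apply: endoP => u /=; rewrite scalerDl. Qed.
HB.instance Definition _ := GRing.Zmodule_isLmodule.Build K endo
  endo_scaleA endo_scale1 endo_scaleDr endo_scaleDl.

Fact endo_scaleAl (a : K) (f g : endo) : a *: (f * g) = a *: f * g.
Proof. exact: endoP. Qed.
HB.instance Definition _ := GRing.Lmodule_isLalgebra.Build K endo endo_scaleAl.
Fact endo_scaleAr (a : K) (f g : endo) : a *: (f * g) = f * (a *: g).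
Proof. by apply: endoP => u /=; rewrite endoZ. Qed.
HB.instance Definition _ := GRing.Lalgebra_isAlgebra.Build K endo endo_scaleAr.

Lemma endo_sumE (I : Type) (r : seq I) (F : I -> endo) u :
  (\sum_(i <- r) F i) u = \sum_(i <- r) F i u.
Proof. by elim/big_rec2: _ => //= i _ f _ <-. Qed.

End FunctionEndomorphisms.

(** * The universal property of the enveloping algebra *)

Section UniversalProperty.
Variables (K : fieldType) (B : finType).
Local Notation g := {ffun B -> K^o}.
Variables (br : g -> g -> g) (A : algType K) (rho : B -> A).

Definition lin_rho (x : g) : A := \sum_b x b *: rho b.

Fact lin_rho_is_linear : linear lin_rho.
Proof.
move=> c u v; rewrite /lin_rho scaler_sumr -big_split; apply: eq_bigr => b _.
by rewrite !ffunE scalerDl scalerA.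
Qed.
HB.instance Definition _ :=
  GRing.isLinear.Build K g A *:%R lin_rho lin_rho_is_linear.

Definition word_rho (m : {fmonom B}) : A := \prod_(b <- (m : seq B)) rho b.

Fact word_rho_mmorph : mmorphism word_rho.
Proof.
split=> [m n|]; last by rewrite /word_rho fm1 big_nil.
by rewrite /word_rho fmM big_cat.
Qed.
HB.instance Definition _ :=
  isMultiplicative.Build {fmonom B} A word_rho word_rho_mmorph.

Definition tensor_lift : tensor_alg K B -> A := mmap (in_alg A) word_rho.

Lemma tensor_liftB : {morph tensor_lift : s t / s - t}.
Proof. exact: raddfB. Qed.

Lemma tensor_liftD : {morph tensor_lift : s t / s + t}.
Proof. exact: raddfD. Qed.

Lemma tensor_liftM : {morph tensor_lift : s t / s * t}.
Proof.
apply: (commr_mmap_is_multiplicative _).1 => t m n.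
by rewrite /GRing.comm /= -scalerAl -scalerAr mul1r mulr1.
Qed.

Lemma tensor_lift1 : tensor_lift 1 = 1.
Proof. exact: mmap1. Qed.

Lemma tensor_liftZ c t : tensor_lift (c *: t) = c *: tensor_lift t.
Proof. by rewrite /tensor_lift mmapZ /= -scalerAl mul1r. Qed.

Lemma tensor_lift_inj x : tensor_lift (tensor_inj x) = lin_rho x.
Proof.
rewrite /tensor_inj /lin_rho /tensor_lift raddf_sum.
apply: eq_bigr => b _; rewrite /= mmapU /= -scalerAl mul1r.
by rewrite /word_rho fmU big_seq1.
Qed.

Hypothesis lin_rho_br : forall u v,
  lin_rho u * lin_rho v - lin_rho v * lin_rho u = lin_rho (br u v).

Definition env_lift (u : envelop br) : A :=
  tensor_lift (repr (u : Quotient.quot (ideal_pred (env_rel br)))).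

Lemma tensor_lift_rel s : env_rel br s -> tensor_lift s = 0.
Proof.
move=> [u [v ->]].
apply: etrans (tensor_liftB _ _) _; rewrite tensor_lift_inj.
apply: etrans (congr1 (fun s => s - _) (tensor_liftB _ _)) _.
apply: etrans (congr1 (fun s => s - _ - _) (tensor_liftM _ _)) _.
apply: etrans (congr1 (fun s => _ - s - _) (tensor_liftM _ _)) _.
by rewrite !tensor_lift_inj lin_rho_br subrr.
Qed.

(** The chosen representative differs from [t] by an element of the ideal of relations, and
    [tensor_lift], being multiplicative, kills that ideal because it kills the generators. Hence
    [env_lift] does not depend on representatives. *)
Lemma env_lift_pi t : env_lift (env_pi br t) = tensor_lift t.
Proof.
apply/eqP; rewrite -subr_eq0 -tensor_liftB; apply/eqP.
have: ideal_gen (env_rel br)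
    (repr (env_pi br t : Quotient.quot (ideal_pred (env_rel br))) - t).
  by apply/env_piP; rewrite env_reprK.
elim=> [s r s' /tensor_lift_rel r0||s t' _ IHs _ IHt].
- by rewrite 2!tensor_liftM r0 mulr0 mul0r.
- exact: raddf0.
- by rewrite tensor_liftB IHs IHt subrr.
Qed.

Lemma env_liftM : {morph env_lift : u v / u * v}.
Proof.
elim/env_ind=> s; elim/env_ind=> t.
apply: etrans (congr1 env_lift (env_mul_pi br s t)) _.
by rewrite !env_lift_pi tensor_liftM.
Qed.

Lemma env_liftD : {morph env_lift : u v / u + v}.
Proof.
by elim/env_ind=> s; elim/env_ind=> t; rewrite -env_piD !env_lift_pi tensor_liftD.
Qed.

Lemma env_liftZ c : {morph env_lift : u / c *: u}.
Proof.
elim/env_ind=> t; apply: etrans (congr1 env_lift (env_scale_pi br c t)) _.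
by rewrite !env_lift_pi tensor_liftZ.
Qed.

Lemma env_lift1 : env_lift 1 = 1.
Proof. exact: etrans (env_lift_pi 1) tensor_lift1. Qed.

Lemma env_liftB : {morph env_lift : u v / u - v}.
Proof. by move=> u v; rewrite env_liftD -scaleN1r env_liftZ scaleN1r. Qed.

Lemma env_lift_inj x : env_lift (env_inj br x) = lin_rho x.
Proof. exact: etrans (env_lift_pi _) (tensor_lift_inj _). Qed.

Lemma env_liftX u n : env_lift (u ^+ n) = env_lift u ^+ n.
Proof.
by elim: n => [|n IHn]; rewrite ?env_lift1 // !exprS env_liftM IHn.
Qed.

End UniversalProperty.

(** * Commutator calculus in an associative algebra *)

Section Commutators.
Variables (K : fieldType) (A : algType K).
Implicit Types a b c : A.

Definition lie a b := a * b - b * a.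

Lemma lieC a b : lie a b = - lie b a.
Proof. by rewrite /lie opprB. Qed.

Lemma lieDl a b c : lie (a + b) c = lie a c + lie b c.
Proof. by rewrite /lie mulrDl mulrDr opprD addrACA. Qed.

Lemma lieDr a b c : lie a (b + c) = lie a b + lie a c.
Proof. by rewrite lieC lieDl opprD -!(lieC a). Qed.

Lemma lie0l a : lie 0 a = 0.
Proof. by rewrite /lie mul0r mulr0 subrr. Qed.

Lemma lie0r a : lie a 0 = 0.
Proof. by rewrite lieC lie0l oppr0. Qed.

Lemma lieNl a b : lie (- a) b = - lie a b.
Proof. by rewrite /lie mulNr mulrN opprB opprK addrC. Qed.

Lemma lieNr a b : lie a (- b) = - lie a b.
Proof. by rewrite lieC lieNl -lieC. Qed.

Lemma lieZl k a b : lie (k *: a) b = k *: lie a b.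
Proof. by rewrite /lie -scalerAl -scalerAr scalerBr. Qed.

Lemma lieZr k a b : lie a (k *: b) = k *: lie a b.
Proof. by rewrite lieC lieZl -scalerN -lieC. Qed.

Lemma lie_suml (I : Type) (r : seq I) (P : pred I) (F : I -> A) b :
  lie (\sum_(i <- r | P i) F i) b = \sum_(i <- r | P i) lie (F i) b.
Proof. by elim/big_rec2: _ => [|i x y _ <-]; rewrite ?lie0l ?lieDl. Qed.

Lemma lie_sumr (I : Type) (r : seq I) (P : pred I) (F : I -> A) b :
  lie b (\sum_(i <- r | P i) F i) = \sum_(i <- r | P i) lie b (F i).
Proof. by elim/big_rec2: _ => [|i x y _ <-]; rewrite ?lie0r ?lieDr. Qed.

Lemma lieMr a b c : lie a (b * c) = lie a b * c + b * lie a c.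
Proof. by rewrite /lie mulrBl mulrBr !mulrA addrA subrK. Qed.

Lemma lieMl a b c : lie (a * b) c = a * lie b c + lie a c * b.
Proof. by rewrite /lie mulrBl mulrBr !mulrA addrA subrK. Qed.

Lemma lie_self a : lie a a = 0.
Proof. by rewrite /lie subrr. Qed.

Lemma lie_scalar a k : lie a k%:A = 0.
Proof. by rewrite /lie -scalerAl -scalerAr mul1r mulr1 subrr. Qed.

Lemma lie_oner a : lie a 1 = 0.
Proof. by rewrite -(scale1r 1) lie_scalar. Qed.

Lemma lie_scalarl a k : lie k%:A a = 0.
Proof. by rewrite lieC lie_scalar oppr0. Qed.

Lemma lie_eq0 a b : lie a b = 0 -> a * b = b * a.
Proof. by move/eqP; rewrite subr_eq0 => /eqP. Qed.

Lemma lieXr0 a b n : lie a b = 0 -> lie a (b ^+ n) = 0.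
Proof.
move=> ab0; elim: n => [|n IHn]; first by rewrite expr0 lie_oner.
by rewrite exprS lieMr ab0 IHn mul0r mulr0 addr0.
Qed.

(** Bracketing with [a] acts as differentiation in [b]. At n = 0 the truncated exponent is harmless,
    since its coefficient is 0. *)
Lemma lieX1 a b n : lie a b = 1 -> lie a (b ^+ n) = n%:R *: b ^+ n.-1.
Proof.
move=> ab1; elim: n => [|n IHn].
  by rewrite expr0 scale0r lie_oner.
rewrite exprS lieMr ab1 IHn mul1r -scalerAr.
case: n {IHn} => [|n]; first by rewrite scale0r addr0 scale1r.
by rewrite /= -exprS (mulrS 1 n.+1) scalerDl scale1r.
Qed.

End Commutators.

(** Antisymmetry of [P_m, P_n]: the two factorials are exchanged, and the sign flips because 2 ell
    is odd. *)
Lemma cga_I_opp (K : fieldType) l n : (n <= l.*2.+1)%N ->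
  cga_I K l (l.*2.+1 - n) = - cga_I K l n.
Proof.
move=> le_n; rewrite /cga_I subKn // mulrAC -!mulNr; congr (_ * _ * _).
rewrite -signr_odd -(signr_odd _ (n + _)) !oddD oddB //= odd_double.
by case: (odd n); case: (odd l); rewrite /= ?expr0 ?expr1 ?opprK.
Qed.

(** The Jacobi identity for H, P_{n+1} and P_{2 ell - n}, read off on the constants I_n. *)
Lemma cga_I_succ (K : fieldType) l n : (n < l.*2.+1)%N ->
  n.+1%:R * cga_I K l n = - ((l.*2.+1 - n)%:R * cga_I K l n.+1).
Proof.
move=> lt_n; rewrite /cga_I addSn exprS factS.
have -> : (l.*2.+1 - n = (l.*2.+1 - n.+1).+1)%N by rewrite subnSK.
rewrite !factS !natrM; move: (l.*2.+1 - n.+1)%N => k.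
by move: (k.+1%:R : K) (n.+1%:R : K) => u v; ring.
Qed.

(** * The Fock representation of the subalgebra without C *)

(* [x] and [a] are creation and annihilation operators; all indices are
   allowed, but only those up to [l] are used. *)
Section Oscillator.
Variables (K : numFieldType) (A : algType K) (l : nat) (delta mu : K).
Variables (x a : nat -> A).
Hypothesis lie_ax : forall i j, lie (a i) (x j) = (i == j)%:R.
Hypothesis lie_aa : forall i j, lie (a i) (a j) = 0.
Hypothesis lie_xx : forall i j, lie (x i) (x j) = 0.

(** The annihilators carry the factor mu I_n, so that bracketing with the matching creator gives mu
    I_n. Nothing is divided by [mu], so mu = 0 is covered too. *)
Definition osc_P n : A :=
  if (n <= l)%N then (mu * cga_I K l n) *: a (l - n) else x (n - l.+1).

Definition osc_D : A :=
  delta%:A - \sum_(j < l.+1) (j.*2.+1)%:R *: (x j * a j).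

(** The bilinear part lowers P_{l+2+j} to P_{l+1+j}. The quadratic part passes from creators to
    annihilators, giving [H, P_{l+1}] = -(l+1) P_l; its 1/2 makes up for the two factors [a 0]. *)
Definition osc_H : A :=
  - \sum_(j < l) (l.+2 + j)%:R *: (x j * a j.+1)
  - (l.+1%:R * mu * cga_I K l l / 2) *: (a 0%N * a 0%N).

Lemma lie_xa_x i k j : lie (x i * a k) (x j) = (k == j)%:R *: x i.
Proof. by rewrite lieMl lie_ax lie_xx mul0r addr0 mulr_natr scaler_nat. Qed.

Lemma lie_xa_a i k j : lie (x i * a k) (a j) = - ((i == j)%:R *: a k).
Proof.
by rewrite lieMl lie_aa mulr0 add0r lieC lie_ax mulNr eq_sym mulr_natl scaler_nat.
Qed.

Lemma lie_osc_D_x k : (k <= l)%N -> lie osc_D (x k) = - (k.*2.+1%:R *: x k).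
Proof.
move=> le_kl; rewrite lieDl lie_scalarl add0r lieNl lie_suml; congr (- _).
rewrite (bigD1 (Ordinal (le_kl : k < l.+1)%N)) //= lieZl lie_xa_x eqxx scale1r.
rewrite big1 ?addr0 // => i /negPf ik.
by rewrite lieZl lie_xa_x [_ == _]ik scale0r scaler0.
Qed.

Lemma lie_osc_D_a k : (k <= l)%N -> lie osc_D (a k) = k.*2.+1%:R *: a k.
Proof.
move=> le_kl; rewrite lieDl lie_scalarl add0r lieNl lie_suml.
rewrite (bigD1 (Ordinal (le_kl : k < l.+1)%N)) //= lieZl lie_xa_a eqxx scale1r.
rewrite big1 ?addr0 ?scalerN ?opprK // => i /negPf ik.
by rewrite lieZl lie_xa_a [_ == _]ik scale0r oppr0 scaler0.
Qed.

Lemma lie_osc_DP n : (n <= l.*2.+1)%N ->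
  lie osc_D (osc_P n) = (l.*2.+1%:R - n.*2%:R) *: osc_P n.
Proof.
move=> le_n; rewrite /osc_P; case: leqP => [le_nl|lt_ln].
  rewrite lieZr lie_osc_D_a ?leq_subr // !scalerA mulrC -natrB; last first.
    by rewrite leqW // leq_double.
  by rewrite doubleB subSn // leq_double.
move: le_n; rewrite -(subnKC lt_ln) addKn; set j := (n - _)%N => le_n.
rewrite lie_osc_D_x; last by move: le_n; rewrite -addnn addSn ltnS leq_add2l.
by rewrite -scaleNr; congr (_ *: _); rewrite -!muln2; ring.
Qed.

Lemma lie_osc_H_a k : (k <= l)%N ->
  lie osc_H (a k) = if (k < l)%N then (l.+2 + k)%:R *: a k.+1 else 0.
Proof.
move=> le_kl; rewrite lieDl !lieNl lieZl lieMl !lie_aa mulr0 mul0r add0r.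
rewrite scaler0 oppr0 addr0 lie_suml; case: ltnP => [lt_kl|le_lk].
  rewrite (bigD1 (Ordinal lt_kl)) //= lieZl lie_xa_a eqxx scale1r.
  rewrite big1 ?addr0 ?scalerN ?opprK // => i /negPf ik.
  by rewrite lieZl lie_xa_a [_ == _]ik scale0r oppr0 scaler0.
rewrite big1 ?oppr0 // => i _.
rewrite lieZl lie_xa_a ltn_eqF ?scale0r ?oppr0 ?scaler0 //.
exact: leq_trans (ltn_ord i) le_lk.
Qed.

Lemma lie_osc_H_x k : (k < l)%N -> lie osc_H (x k.+1) = - ((l.+2 + k)%:R *: x k).
Proof.
move=> lt_kl; rewrite lieDl !lieNl lieZl lieMl !lie_ax mulr0 mul0r add0r.
rewrite scaler0 oppr0 addr0 lie_suml; congr (- _).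
rewrite (bigD1 (Ordinal lt_kl)) //= lieZl lie_xa_x eqxx scale1r.
rewrite big1 ?addr0 // => i /negPf ik.
by rewrite lieZl lie_xa_x eqSS [_ == _]ik scale0r scaler0.
Qed.

Lemma lie_osc_H_x0 : lie osc_H (x 0%N) = - (l.+1%:R *: osc_P l).
Proof.
rewrite lieDl !lieNl lieZl lieMl !lie_ax mulr1 mul1r lie_suml big1; last first.
  by move=> i _; rewrite lieZl lie_xa_x scale0r scaler0.
rewrite oppr0 add0r /osc_P leqnn subnn -mulr2n -scaler_nat !scalerA.
by congr (- (_ *: _)); field.
Qed.

Lemma lie_osc_HP n : (n <= l.*2.+1)%N ->
  lie osc_H (osc_P n) = - (n%:R *: osc_P n.-1).
Proof.
move=> le_n; have [le_nl|lt_ln] := leqP n l.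
  rewrite {1}/osc_P le_nl lieZr lie_osc_H_a ?leq_subr //.
  case: n le_nl {le_n} => [|n] lt_nl.
    by rewrite subn0 ltnn scaler0 scale0r oppr0.
  rewrite ltn_subrL /= (leq_ltn_trans _ lt_nl) // /osc_P /= ltnW //.
  rewrite subnSK // !scalerA -scaleNr; congr (_ *: _).
  rewrite [in RHS]mulrCA.
  (* Trades (n+1) I_n for -(2l+1-n) I_{n+1}, whose coefficient is the one produced by the bilinear
     part of H. *)
  rewrite cga_I_succ; last by rewrite ltnS -addnn (leq_trans (ltnW lt_nl)) ?leq_addl.
  rewrite mulrN opprK -mulrA; congr (_ * _); rewrite mulrC; congr (_%:R * _).
  by rewrite addnBA // !addSn addnn subSS.
move: le_n; rewrite -(subnKC lt_ln); set j := (n - _)%N => le_n.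
have -> : osc_P (l.+1 + j) = x j by rewrite /osc_P addSn ltnNge leq_addr subSS addKn.
case: j le_n => [|j] le_n; first by rewrite addn0 lie_osc_H_x0.
rewrite lie_osc_H_x; last by move: le_n; rewrite -addnn addSn ltnS leq_add2l.
by rewrite addnS /= /osc_P addSn ltnNge leq_addr subSS addKn.
Qed.

(** Every monomial of [osc_H] has weight 2: (2j+3) - (2j+1) for x_j a_{j+1}, and 1 + 1 for a_0
    a_0. *)
Lemma lie_osc_DH : lie osc_D osc_H = 2 *: osc_H.
Proof.
rewrite {2}/osc_H scalerDr !scalerN /osc_H lieDr !lieNr lieZr lieMr lie_osc_D_a //.
congr (- _ - _).
  rewrite lie_sumr scaler_sumr; apply: eq_bigr => i _.
  rewrite lieZr lieMr (lie_osc_D_a (ltn_ord i)).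
  rewrite (lie_osc_D_x (ltnW (ltn_ord i))).
  rewrite mulNr -scalerAl -scalerAr -scaleNr -scalerDl !scalerA; congr (_ *: _).
  by rewrite -!muln2; ring.
by rewrite -scalerAl -scalerAr -scalerDl !scalerA mulrC.
Qed.

Lemma lie_osc_PP m n : (m <= l.*2.+1)%N -> (n <= l.*2.+1)%N ->
  lie (osc_P m) (osc_P n) =
  if (m + n == l.*2.+1)%N then (mu * cga_I K l m)%:A else 0.
Proof.
move=> le_m le_n; rewrite /osc_P; case: leqP => lm; case: leqP => ln.
- rewrite lieZl lieZr lie_aa !scaler0 ltn_eqF // ltnS -addnn.
  exact: leq_add.
- rewrite lieZl lie_ax -[(l - m == _)%N](eqn_add2r (m + l.+1)).
  rewrite addnA subnK // addnS addnn addnCA subnK // eq_sym.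
  by case: eqP => _; rewrite ?scaler0.
- rewrite lieZr lieC lie_ax eq_sym -[(m - _ == _)%N](eqn_add2r (n + l.+1)).
  rewrite addnCA subnK // addnA subnK // addnS addnn addnC.
  (* With the creator on the left the bracket is - mu I_n; [cga_I_opp] turns this into mu I_m, as m
     + n = 2 ell. *)
  case: eqP => [e|_]; rewrite ?oppr0 ?scaler0 // scalerN -scaleNr -mulrN.
  by rewrite -cga_I_opp // -e addnK.
- rewrite lie_xx gtn_eqF // -addnn -addnS.
  exact: leq_trans (leq_add lm ln).
Qed.

End Oscillator.

(** * Induction to the whole algebra *)

(* [c] and [- z] form one more boson.  [ind_P n] is [p n] conjugated by the
   exponential of [z (x) ad C], as (ad C)^i P_n is
   (2 ell - n)! / (2 ell - n - i)! P_{n+i}. *)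
Section Induction.
Variables (K : numFieldType) (A : algType K) (l : nat) (mu : K).
Local Notation N := l.*2.+1.
Variables (p : nat -> A) (d h c z : A).
Hypothesis lie_pp : forall m n, (m <= N)%N -> (n <= N)%N ->
  lie (p m) (p n) = if (m + n == N)%N then (mu * cga_I K l m)%:A else 0.
Hypothesis lie_dp : forall n, (n <= N)%N ->
  lie d (p n) = (N%:R - n.*2%:R) *: p n.
Hypothesis lie_hp : forall n, (n <= N)%N -> lie h (p n) = - (n%:R *: p n.-1).
Hypothesis lie_dh : lie d h = 2 *: h.
Hypothesis lie_cz : lie c z = 1.
Hypothesis lie_cp : forall n, (n <= N)%N -> lie c (p n) = 0.
Hypothesis lie_cd : lie c d = 0.
Hypothesis lie_ch : lie c h = 0.
Hypothesis lie_zp : forall n, (n <= N)%N -> lie z (p n) = 0.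
Hypothesis lie_zd : lie z d = 0.
Hypothesis lie_zh : lie z h = 0.

(** On c^k w in the induced module, [z] is minus the derivative in [c]. Moving D past c^k adds -2k,
    which is the term 2 c z; moving H past c^k leaves -k c^(k-1) d + k(k-1) c^(k-1), which are z d
    and c z^2. *)
Definition ind_D := d + 2 *: (c * z).
Definition ind_H := h + z * d + c * (z * z).
Definition ind_P n := \sum_(i < N.+1 - n) 'C(N - n, i)%:R *: (z ^+ i * p (n + i)).

Let lie_zX_p i n : (n <= N)%N -> lie (z ^+ i) (p n) = 0.
Proof. by move=> le_n; rewrite lieC lieXr0 ?oppr0 // lieC lie_zp ?oppr0. Qed.

Let lie_zz i : lie z (z ^+ i) = 0.
Proof. by rewrite lieXr0 // lie_self. Qed.

Let lie_hzX i : lie h (z ^+ i) = 0.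
Proof. by rewrite lieXr0 // lieC lie_zh oppr0. Qed.

Let lie_dzX i : lie d (z ^+ i) = 0.
Proof. by rewrite lieXr0 // lieC lie_zd oppr0. Qed.

Let zX_pred i : i%:R *: z ^+ i.-1 * z = i%:R *: z ^+ i.
Proof. by case: i => [|i]; rewrite -scalerAl ?scale0r // -exprSr. Qed.

Let zp n : (n <= N)%N -> p n * z = z * p n.
Proof. by move=> le_n; rewrite (lie_eq0 (lie_zp le_n)). Qed.

Lemma lie_ind_CD : lie c ind_D = 2 *: c.
Proof.
by rewrite lieDr lie_cd add0r lieZr lieMr lie_self mul0r add0r lie_cz mulr1.
Qed.

Lemma lie_ind_CH : lie c ind_H = ind_D.
Proof.
rewrite !lieDr lie_ch add0r !lieMr lie_cz lie_cd lie_self !mul1r mulr0 addr0.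
by rewrite mul0r add0r mulr1 -mulr2n -scaler_nat -scalerAr.
Qed.

Lemma lie_ind_DH : lie ind_D ind_H = 2 *: ind_H.
Proof.
have dz : lie d z = 0 by rewrite lieC lie_zd oppr0.
have dc : lie d c = 0 by rewrite lieC lie_cd oppr0.
have zc1 : lie z c = -1 by rewrite lieC lie_cz.
have dh : lie d ind_H = 2 *: h.
  by rewrite !lieDr lie_dh !lieMr dz dc lie_self !(mulr0, mul0r, addr0).
have czh : lie (c * z) h = 0 by rewrite lieMl lie_zh lie_ch mulr0 mul0r addr0.
have czd : lie (c * z) d = 0 by rewrite lieMl lie_zd lie_cd mulr0 mul0r addr0.
have czz : lie (c * z) z = z by rewrite lieMl lie_self lie_cz mulr0 mul1r add0r.
have czc : lie (c * z) c = - c.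
  by rewrite lieMl zc1 lie_self mul0r addr0 mulrN1.
rewrite lieDl dh lieZl -scalerDr; congr (_ *: _).
rewrite /ind_H !lieDr czh !lieMr czd czz czc mulr0 addr0 add0r -addrA.
by congr (_ + (_ + _)); rewrite mulrDr mulNr addKr.
Qed.

Lemma ind_P_eq0 n : (N < n)%N -> ind_P n = 0.
Proof. by rewrite /ind_P -subn_eq0 => /eqP ->; rewrite big_ord0. Qed.

Lemma ind_P_nat n : (n <= N)%N ->
  ind_P n = \sum_(0 <= i < (N - n).+1) 'C(N - n, i)%:R *: (z ^+ i * p (n + i)).
Proof. by move=> le_n; rewrite big_mkord /ind_P subSn. Qed.

Let le_nat n i : (n <= N)%N -> (i < (N - n).+1)%N -> (n + i <= N)%N.
Proof. by move=> le_n; rewrite ltnS leq_subRL. Qed.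

(** Bracketing with [c] differentiates in [z], and the absorption identity i C(r, i) = r C(r-1, i-1)
    turns the derivative of the sum for P_n into a multiple of the sum for P_{n+1}. *)
Lemma lie_ind_CP n : (n <= N)%N -> lie c (ind_P n) = (N - n)%:R *: ind_P n.+1.
Proof.
move=> le_n; rewrite ind_P_nat // lie_sumr big_nat_recl // lieZr lieMr.
rewrite lie_cp ?addn0 // expr0 lie_oner mul0r mulr0 addr0 scaler0.
rewrite add0r /ind_P subSS scaler_sumr big_mkord.
apply: eq_bigr => i _; have lt_i := ltn_ord i.
rewrite lieZr lieMr (lieX1 _ lie_cz) lie_cp ?mulr0 ?addr0; last first.
  by rewrite -leq_subRL.
rewrite -scalerAl !scalerA addSnnS /= -!natrM; congr (_%:R *: _).
by rewrite subnS mulnC mul_bin_diag.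
Qed.

(** All terms have the same weight: z^i gains 2i from 2 c z, which offsets the shift from [p n] to
    [p (n + i)]. *)
Lemma lie_ind_DP n : (n <= N)%N ->
  lie ind_D (ind_P n) = (N%:R - n.*2%:R) *: ind_P n.
Proof.
move=> le_n; rewrite ind_P_nat // lie_sumr scaler_sumr.
apply: eq_big_nat => i /andP[_ lt_i]; have le_ni := le_nat le_n lt_i.
rewrite lieZr [in RHS]scalerA mulrC -scalerA; congr (_ *: _).
rewrite lieDl lieMr lie_dzX mul0r add0r lie_dp // lieZl lieMl.
rewrite (lieMr c) lie_cp // (lieX1 _ lie_cz) (lieMr z) lie_zz lie_zp //.
rewrite mul0r !mulr0 !addr0 mulr0 add0r -mulrA.
rewrite zp // mulrA zX_pred -scalerAl -scalerAr.
by rewrite scalerA -scalerDl; congr (_ *: _); rewrite -!muln2; ring.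
Qed.

Let lie_H_zXp n i : (n + i <= N)%N -> lie ind_H (z ^+ i * p (n + i)) =
  (N%:R - n.*2%:R - i%:R) *: (z ^+ i.+1 * p (n + i))
  - (n + i)%:R *: (z ^+ i * p (n + i).-1).
Proof.
move=> le_ni; rewrite !lieDl lieMr lie_hzX mul0r add0r lie_hp // mulrN -scalerAr.
rewrite (lieMl z d) (lieMr d) lie_dzX mul0r add0r lie_dp //.
rewrite (lieMr z) lie_zz lie_zp // mul0r mulr0 addr0 mul0r addr0.
rewrite (lieMl c) (lieMl z z) (lieMr z) lie_zz lie_zp // mul0r mulr0 addr0.
rewrite mul0r mulr0 addr0 mulr0 add0r lieMr (lieX1 _ lie_cz) lie_cp // mulr0 addr0.
have -> : i%:R *: z ^+ i.-1 * p (n + i) * (z * z) = i%:R *: (z ^+ i.+1 * p (n + i)).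
  rewrite -mulrA (mulrA (p _)) zp // -mulrA zp // !mulrA.
  by rewrite zX_pred -!scalerAl -exprSr.
rewrite -!scalerAr mulrA -exprS -addrA -scalerDl addrC.
by congr (_ *: _ - _); rewrite -!muln2; ring.
Qed.

(** Both sides are expanded in z^k p_{n+k-1} and compared coefficientwise. The sum for P_{n-1} has
    one term more than that for P_n, and Pascal's rule accounts for the difference. *)
Lemma lie_ind_HP n : (n <= N)%N -> lie ind_H (ind_P n) = - (n%:R *: ind_P n.-1).
Proof.
move=> le_n; pose F k := z ^+ k * p (n + k).-1; set r := (N - n)%N.
transitivity (- (n%:R *: \sum_(0 <= k < r.+2) 'C(r.+1, k)%:R *: F k)); last first.
  case: n le_n @r @F => [|n] le_n r F; first by rewrite !scale0r.
  by rewrite [in RHS]ind_P_nat ?(ltnW le_n) //= /r subnSK.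
rewrite ind_P_nat // lie_sumr -/r.
under eq_big_nat => i /andP[_ lt_i].
  rewrite lieZr lie_H_zXp ?le_nat // scalerBr !scalerA; over.
(* The added term at i = r + 1 has binomial coefficient 0; it aligns the lowering sum with the
   shifted one. *)
have ext : \sum_(0 <= i < r.+1) ('C(r, i)%:R * (n + i)%:R) *: F i = n%:R *: F 0%N +
    \sum_(0 <= i < r.+1) ('C(r, i.+1)%:R * (n + i.+1)%:R) *: F i.+1.
  transitivity (\sum_(0 <= i < r.+2) ('C(r, i)%:R * (n + i)%:R) *: F i).
    by rewrite [RHS]big_nat_recr //= bin_small // mul0r scale0r addr0.
  by rewrite big_nat_recl // bin0 mul1r addn0.
rewrite sumrB /= ext [in RHS]big_nat_recl // bin0 scale1r scalerDr !opprD.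
rewrite addrCA; congr (_ + _).
rewrite scaler_sumr -!sumrN -big_split; apply: eq_big_nat => i /andP[_ lt_i] /=.
rewrite /F addnS /= -scaleNr -scalerDl scalerA -scaleNr; congr (_ *: _).
have -> : N%:R = n%:R + r%:R :> K by rewrite -natrD subnKC.
(* The identity (i+1) C(r, i+1) = (r-i) C(r, i) removes the index from the coefficients, leaving -n
   times the Pascal sum. *)
have := mul_bin_left r i; move/(congr1 (fun k : nat => k%:R : K)).
rewrite binS !natrM natrB // natrD -muln2 natrM -addnS natrD => e.
by rewrite !mulrDr [_ * i.+1%:R]mulrC e; ring.
Qed.

Let lie_zXp_zXp i j m n : (m <= N)%N -> (n <= N)%N ->
  lie (z ^+ i * p m) (z ^+ j * p n) =
  if (m + n == N)%N then (mu * cga_I K l m) *: z ^+ (i + j) else 0.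
Proof.
move=> le_m le_n; have zXz k : lie (z ^+ k) (z ^+ j) = 0.
  by rewrite lieC lieXr0 ?oppr0 // lieC lie_zz oppr0.
rewrite lieMl !lieMr zXz lie_zX_p // [lie (p m) (z ^+ j)]lieC lie_zX_p // lie_pp //.
rewrite oppr0 !mul0r mulr0 !add0r mul0r addr0.
by case: eqP => _; rewrite ?mulr0 // -!scalerAr mulr1 -exprD.
Qed.

(** This is the coefficient of z^s in [P_m, P_n] when N - n = m + s. Multiplied by s!, the
    factorials regroup into C(s, i) and the sum becomes, up to a constant factor, the binomial
    expansion of (1 - 1)^s. *)
Lemma sum_bin_cga_I m s : (m + s <= N)%N ->
  \sum_(0 <= i < s.+1) 'C(N - m, i)%:R * 'C(m + s, s - i)%:R * cga_I K l (m + i)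
  = if s == 0%N then cga_I K l m else 0.
Proof.
case: s => [|s] le_ms; first by rewrite big_nat1 bin0 bin0 !mul1r addn0.
apply: (mulfI (x := (s.+1`!)%:R)); first by rewrite pnatr_eq0 -lt0n fact_gt0.
rewrite mulr0 mulr_sumr.
transitivity (((N - m)`! * (m + s.+1)`!)%:R * (-1) ^+ (m + l.+1) * (1 - 1) ^+ s.+1 : K).
  rewrite exprDn mulr_sumr big_mkord; apply: eq_bigr => i _.
  rewrite /cga_I expr1n mul1r -[X in _ = _ * X]mulr_natr addnAC (exprD _ (m + l.+1)).
  move: ((-1) ^+ (m + l.+1)) => sg.
  have le_i : (i <= s.+1)%N by rewrite -ltnS.
  have le_im : (i <= N - m)%N.
    by rewrite (leq_trans le_i) // -(leq_add2l m) (leq_trans le_ms) // -leq_subLR.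
  have e : (s.+1`! * ('C(N - m, i) * 'C(m + s.+1, s.+1 - i) *
      ((m + i)`! * (N - (m + i))`!)) = (N - m)`! * (m + s.+1)`! * 'C(s.+1, i))%N.
    have fact_i : (0 < i`! * (s.+1 - i)`!)%N by rewrite muln_gt0 !fact_gt0.
    apply/eqP; rewrite -(eqn_pmul2r fact_i) -[X in _ == X]mulnA bin_fact //.
    rewrite -(bin_fact le_im).
    have le_r : (s.+1 - i <= m + s.+1)%N.
      by rewrite (leq_trans (leq_subr _ _)) ?leq_addl.
    have mi : (m + s.+1 - (s.+1 - i) = m + i)%N.
      by rewrite -addnBA ?leq_subr // subKn.
    rewrite -(bin_fact le_r) subnDA mi.
    by apply/eqP; ring.
  move: (s.+1`!) e => f /(congr1 (fun k : nat => k%:R : K)); rewrite !natrM => e.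
  transitivity (sg * (-1) ^+ i *
    ((N - m)`!%:R * (m + s.+1)`!%:R * 'C(s.+1, i)%:R) : K); last by ring.
  by rewrite -e; ring.
by rewrite subrr expr0n mulr0.
Qed.

(** Since [z] commutes with the [p n], the (i, j) term is a multiple of z^(i+j), non-zero only if m
    + n + i + j = N. For m + n <= N everything thus lies in degree s = N - m - n, where
    [sum_bin_cga_I] applies. *)
Lemma lie_ind_PP m n : (m <= N)%N -> (n <= N)%N ->
  lie (ind_P m) (ind_P n) =
  if (m + n == N)%N then (mu * cga_I K l m)%:A else 0.
Proof.
move=> le_m le_n; rewrite !ind_P_nat // lie_suml.
under eq_big_nat => i /andP[_ lt_i].
  rewrite lie_sumr; under eq_big_nat => j /andP[_ lt_j].
    rewrite lieZl lieZr lie_zXp_zXp ?le_nat // scalerA; over.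
  over.
have [lt_mn|le_mn] := ltnP N (m + n).
  rewrite gtn_eqF // big_nat big1 // => i _; rewrite big_nat big1 // => j _.
  by rewrite addnACA gtn_eqF ?scaler0 // ltn_addr.
set s := (N - (m + n))%N.
have Ns : N = (m + n + s)%N by rewrite subnKC.
transitivity (\sum_(0 <= i < s.+1)
  (mu * ('C(N - m, i)%:R * 'C(m + s, s - i)%:R * cga_I K l (m + i))) *: z ^+ s).
  rewrite [RHS](big_nat_widen _ _ (N - m).+1); last first.
    by rewrite ltnS /s subnDA leq_subr.
  rewrite [RHS]big_mkcond; apply: eq_big_nat => i /andP[_ lt_i] /=.
  have key j : (m + i + (n + j) == N)%N = (i + j == s)%N.
    by rewrite [N in LHS]Ns addnACA eqn_add2l.
  rewrite ltnS; case: leqP => [le_is|lt_si]; last first.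
    by rewrite big1 // => j _; rewrite key gtn_eqF ?scaler0 // ltn_addr.
  rewrite (bigD1_seq (s - i)%N) ?iota_uniq ?mem_index_iota //=; last first.
    by rewrite ltnS (leq_trans (leq_subr _ _)) // /s addnC subnDA leq_subr.
  rewrite key subnKC // eqxx big1 ?addr0 => [|j ji]; last first.
    by rewrite key -(subnKC le_is) eqn_add2l (negPf ji) scaler0.
  have -> : (N - n = m + s)%N by rewrite [N]Ns addnAC addnK.
  by rewrite scalerA mulrCA.
rewrite -scaler_suml -mulr_sumr sum_bin_cga_I; last by rewrite [N]Ns addnAC leq_addr.
rewrite (_ : (m + n == N)%N = (s == 0)%N); last by rewrite eqn_leq le_mn /= -subn_eq0.
by case: eqP => [->|_]; rewrite ?expr0 // mulr0 scale0r.
Qed.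

End Induction.

(** * The representation of the full conformal Galilei algebra by bosons *)

Section Representation.
Variables (K : numFieldType) (A : algType K) (l : nat) (delta mu : K).
Variables (x a : nat -> A).
Hypothesis lie_ax : forall i j, lie (a i) (x j) = (i == j)%:R.
Hypothesis lie_aa : forall i j, lie (a i) (a j) = 0.
Hypothesis lie_xx : forall i j, lie (x i) (x j) = 0.
Local Notation N := l.*2.+1.

Local Notation xs := (fun j => x j.+1).
Local Notation as_ := (fun j => a j.+1).
Let p := osc_P l mu xs as_.
Let d := osc_D l delta xs as_.
Let h := osc_H l mu xs as_.

(** Boson 0 serves the induction, with c = x_0 and z = - a_0 so that [c, z] = 1; boson j + 1 is the
    oscillator of P_{l+1+j}. *)
Definition verma_rho (b : cga_gen l) : A :=
  match b with
  | GenC => x 0%N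
  | GenD => ind_D d (x 0%N) (- a 0%N)
  | GenH => ind_H d h (x 0%N) (- a 0%N)
  | GenM => mu%:A
  | GenP n => ind_P l p (- a 0%N) n
  end.

Let lie_osc u : (forall j, lie u (x j.+1) = 0) -> (forall j, lie u (a j.+1) = 0) ->
  [/\ forall n, lie u (p n) = 0, lie u d = 0 & lie u h = 0].
Proof.
move=> ux ua; have uxa i j : lie u (x i.+1 * a j.+1) = 0.
  by rewrite lieMr ux ua mul0r mulr0 addr0.
split=> [n||].
- by rewrite /p /osc_P; case: ifP => _; rewrite ?lieZr ?ua ?ux ?scaler0.
- rewrite lieDr lieNr lie_scalar lie_sumr big1 ?oppr0 ?addr0 // => j _.
  by rewrite lieZr uxa scaler0.
- rewrite lieDr !lieNr lieZr lieMr !ua mul0r mulr0 addr0 scaler0 lie_sumr.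
  by rewrite big1 ?oppr0 ?addr0 // => j _; rewrite lieZr uxa scaler0.
Qed.

Let lie_cz : lie (x 0%N) (- a 0%N) = 1.
Proof. by rewrite lieNr -lieC lie_ax. Qed.

Let lie_c : [/\ forall n, lie (x 0%N) (p n) = 0, lie (x 0%N) d = 0 & lie (x 0%N) h = 0].
Proof. by apply: lie_osc => j; [exact: lie_xx | rewrite lieC lie_ax oppr0]. Qed.

Let lie_z :
  [/\ forall n, lie (- a 0%N) (p n) = 0, lie (- a 0%N) d = 0 & lie (- a 0%N) h = 0].
Proof. by apply: lie_osc => j; rewrite lieNl ?lie_ax ?lie_aa oppr0. Qed.

Let axS i j : lie (as_ i) (xs j) = (i == j)%:R.
Proof. by rewrite lie_ax eqSS. Qed.
Let aaS i j : lie (as_ i) (as_ j) = 0. Proof. exact: lie_aa. Qed.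
Let xxS i j : lie (xs i) (xs j) = 0. Proof. exact: lie_xx. Qed.

Lemma lin_rho_basis b : lin_rho verma_rho (cga_basis K b) = verma_rho b.
Proof.
rewrite /lin_rho (bigD1 b) //= ffunE eqxx scale1r big1 ?addr0 // => b' b'b.
by rewrite ffunE (negPf b'b) scale0r.
Qed.

Lemma vP_basis n (lt_n : (n < l.*2.+2)%N) :
  vP K l n = cga_basis K (GenP (Ordinal lt_n)).
Proof.
by apply/ffunP => b; rewrite !ffunE; case: b.
Qed.

Lemma vP_eq0 n : (l.*2.+1 < n)%N -> vP K l n = 0.
Proof.
move=> lt_n; apply/ffunP => b; rewrite !ffunE; case: b => // i.
by rewrite ltn_eqF // (leq_trans (ltn_ord i)).
Qed.

Lemma lin_rho_P n : lin_rho verma_rho (vP K l n) = ind_P l p (- a 0%N) n.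
Proof.
have [lt_n|le_n] := ltnP n l.*2.+2; first by rewrite (vP_basis lt_n) lin_rho_basis.
by rewrite vP_eq0 // raddf0 ind_P_eq0.
Qed.

Lemma lie_verma_rho b b' :
  lie (verma_rho b) (verma_rho b') = lin_rho verma_rho (cga_bracket_basis K b b').
Proof.
have pp := @lie_osc_PP _ _ l mu _ _ axS aaS xxS.
have dp := @lie_osc_DP _ _ l delta mu _ _ axS aaS xxS.
have hp := @lie_osc_HP _ _ l mu _ _ axS aaS xxS.
have dh := @lie_osc_DH _ _ l delta mu _ _ axS aaS xxS.
have [cp cd ch] := lie_c; have [zp zd zh] := lie_z.
have cp' n (_ : (n <= N)%N) := cp n; have zp' n (_ : (n <= N)%N) := zp n.
have CD := lie_ind_CD lie_cz cd; have CH := lie_ind_CH lie_cz cd ch.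
have DH := lie_ind_DH dh lie_cz cd ch zd zh.
have CP n : (n <= N)%N -> _ := lie_ind_CP lie_cz cp' (n := n).
have DP n : (n <= N)%N -> _ := lie_ind_DP dp lie_cz cp' zp' zd (n := n).
have HP n : (n <= N)%N -> _ := lie_ind_HP dp hp lie_cz cp' zp' zd zh (n := n).
have PP := lie_ind_PP pp zp'.
have two_ell : 2 * ell K l = N%:R.
  by rewrite /ell -muln2 -(addn1 (l * 2)) natrD natrM; field.
have le_ord (n : 'I_N.+1) : (n <= N)%N by rewrite -ltnS.
have twoE (n : 'I_N.+1) : 2 * (ell K l - n%:R) = N%:R - n.*2%:R.
  by rewrite mulrBr two_ell -[n.*2]mul2n natrM.
have CPE (n : 'I_N.+1) : 2 * ell K l - n%:R = (N - n)%:R.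
  by rewrite two_ell natrB.
have [lC lD lH lM] := And4 (lin_rho_basis (GenC l)) (lin_rho_basis (GenD l))
  (lin_rho_basis (GenH l)) (lin_rho_basis (GenM l)).
(* Of the 25 pairs, rewriting settles those with M, the diagonal ones outside P, and CD, CH, DH; the
   rest need the rules for P or antisymmetry. *)
case: b => [||||m]; case: b' => [||||n] /=;
  rewrite ?raddf0 ?linearN ?linearZ /= ?lin_rho_P ?lC ?lD ?lH ?lie_self
    ?lie_scalar ?lie_scalarl ?CD ?CH ?DH ?twoE ?CPE //=.
- by rewrite CP ?lin_rho_P.
- by rewrite lieC CD scalerN.
- by rewrite DP ?lin_rho_P.
- by rewrite lieC CH.
- by rewrite lieC DH scalerN.
- by rewrite HP ?lin_rho_P // scalerN.
- by rewrite lieC CP ?lin_rho_P // scalerN.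
- by rewrite lieC DP ?lin_rho_P // scalerN.
- by rewrite lieC HP ?lin_rho_P // opprK.
- rewrite PP //; case: eqP => _; last by rewrite raddf0.
  by rewrite linearZ /= lM /= scalerA mulrC.
Qed.

Lemma lin_rho_cga_bracket u v :
  lin_rho verma_rho u * lin_rho verma_rho v - lin_rho verma_rho v * lin_rho verma_rho u
  = lin_rho verma_rho (cga_bracket u v).
Proof.
rewrite -/(lie _ _) /cga_bracket {1 2}/lin_rho lie_suml linear_sum.
apply: eq_bigr => b _; rewrite linear_sum lie_sumr; apply: eq_bigr => b' _.
by rewrite lieZl lieZr lie_verma_rho scalerA [in RHS]linearZ mulrC.
Qed.

End Representation.

(** * Nonvanishing in the Verma module *)

(* A function of multi-indices is a formal power series in the variables of
   infinitely many bosons, its values being the coefficients multiplied by the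
   factorials of the exponents: this makes annihilation a shift. *)
Section FunctionModel.
Variable K : numFieldType.
Local Notation W := ((nat -> nat) -> K^o).
Implicit Types (f : W) (n : nat -> nat).

Fact lower_linear i : linear (fun f n => f (fun j => n j + (j == i))%N : K^o).
Proof. by []. Qed.

Fact raise_linear i :
  linear (fun f n => (n i)%:R * f (fun j => n j - (j == i))%N : K^o).
Proof. by move=> c f g; apply/funext => n; rewrite [LHS]mulrDr mulrCA. Qed.

Definition lower i : endo K (nat -> nat) := Endo (lower_linear i).
(** Multiplication by the i-th variable in the normalization by factorials. Where n i = 0 the
    truncated subtraction is cancelled by the factor n i. *)
Definition raise i : endo K (nat -> nat) := Endo (raise_linear i).

Lemma lie_lower_raise i j : lie (lower i) (raise j) = (i == j)%:R.
Proof.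
apply: endoP => f; apply/funext => n.
transitivity ((n j + (j == i))%:R * f (fun k => n k + (k == i) - (k == j))%N
   - (n j)%:R * f (fun k => n k - (k == j) + (k == i))%N) => //.
have [<-{j}|ij] := eqVneq i j.
  rewrite addn1 (_ : (fun k => _ - _)%N = n); last first.
    by apply/funext => k; rewrite addnK.
  case ni: (n i) => [|m]; first by rewrite mul0r subr0 mul1r.
  rewrite (_ : (fun k => _ + _)%N = n).
    by rewrite -mulrBl -natrB // subSnn mul1r.
  by apply/funext => k; case: eqP => [->|_]; rewrite ?ni ?subn0 ?addn0 // subn1 addn1.
rewrite addn0 (_ : (fun k => _ - _)%N = (fun k => n k - (k == j) + (k == i))%N).
  by rewrite subrr.
apply/funext => k; case: (eqVneq k j) => [->|_]; last by rewrite !subn0.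
by rewrite eq_sym (negPf ij) !addn0.
Qed.

Lemma lie_lower_lower i j : lie (lower i) (lower j) = 0.
Proof.
apply: endoP => f; apply/funext => n; apply/eqP; rewrite subr_eq0; apply/eqP.
by congr (f _); apply/funext => k; rewrite addnAC.
Qed.

Lemma lie_raise_raise i j : lie (raise i) (raise j) = 0.
Proof.
apply: endoP => f; apply/funext => n; apply/eqP; rewrite subr_eq0; apply/eqP => /=.
have [->//|ij] := eqVneq i j.
rewrite !subn0 mulrCA; congr (_ * (_ * f _)).
by apply/funext => k; rewrite subnAC.
Qed.

(** The constant series 1. Vanishing at all positions is a condition on infinitely many indices,
    hence decided classically. *)
Definition vacuum : W := fun n => `[< forall j, n j = 0%N >]%:R.

Lemma lower_vacuum i : lower i vacuum = 0.
Proof.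
apply/funext => n /=; rewrite /vacuum asboolF // => /(_ i).
by rewrite eqxx addn1.
Qed.

(* The evaluation at the multi-index with [k] at position 1 and 0 elsewhere;
   position 0 is the boson of C and position 1 that of P_{l+1}. *)
Definition coef1 k f : K := f (fun j => k * (j == 1))%N.

Lemma coef1_raise0 i k f : i != 1%N -> coef1 k (raise i f) = 0.
Proof. by move=> i1; rewrite /coef1 /= (negPf i1) muln0 mul0r. Qed.

Lemma coef1_raise1 k f : coef1 k.+1 (raise 1 f) = k.+1%:R * coef1 k f.
Proof.
rewrite /coef1 /= muln1; congr (_ * f _).
by apply/funext => j; rewrite mulSn addKn.
Qed.

End FunctionModel.

Lemma lquot_pi0 (A : pzRingType) (S : A -> Prop) : lquot_pi S 0 = 0.
Proof. by rewrite -(subrr (0 : A)) lquot_piB subrr. Qed.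

Lemma cga_plus_ind (K : fieldType) l (Q : cga K l -> Prop) :
  Q (vH K l) -> (forall j, (j <= l)%N -> Q (vP K l j)) ->
  (forall c u v, Q u -> Q v -> Q (c *: u + v)) ->
  forall u, u \in cga_plus K l -> Q u.
Proof.
move=> QH QP Qlin; rewrite /cga_plus; set s := (_ :: _).
have Q0 : Q 0 by rewrite -(addNr (vH K l)) -scaleN1r; exact: Qlin.
have Qs v : v \in s -> Q v.
  rewrite inE => /predU1P[-> //|/mapP[j]]; rewrite mem_iota => le_j ->.
  exact: QP.
move=> u /(coord_span (X := in_tuple s)) ->.
apply: big_ind => // [v w Qv Qw|i _]; first by rewrite -(scale1r v); exact: Qlin.
by rewrite -[_ *: _]addr0; apply: Qlin => //; apply/Qs/mem_nth.
Qed.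

Section VermaNonvanishing.
Variables (K : numFieldType) (l : nat) (delta mu : K).
Local Notation N := l.*2.+1.
Local Notation x := (@raise K).
Local Notation a := (@lower K).
Local Notation xs := (fun j => x j.+1).
Local Notation as_ := (fun j => a j.+1).
Local Notation p := (osc_P l mu xs as_).
Local Notation d := (osc_D l delta xs as_).
Local Notation h := (osc_H l mu xs as_).
Local Notation z := (- a 0%N).
Local Notation P := (ind_P l p z).
Local Notation vac := (vacuum K).

Definition fock_rho : cga_gen l -> endo K (nat -> nat) :=
  verma_rho delta mu x a.

Lemma lower_pow_vacuum i : (0 < i)%N -> (z ^+ i) vac = 0.
Proof.
case: i => // i _; rewrite exprSr.
have -> : (z ^+ i * z) vac = (z ^+ i) (- a 0%N vac) by [].
by rewrite lower_vacuum oppr0 endo0.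
Qed.

Lemma osc_D_vacuum : d vac = delta *: vac.
Proof.
rewrite /osc_D.
have -> : (delta%:A - \sum_(j < l.+1) j.*2.+1%:R *: (xs j * as_ j)) vac =
  delta *: vac - (\sum_(j < l.+1) j.*2.+1%:R *: (xs j * as_ j)) vac by [].
rewrite endo_sumE big1 ?subr0 // => j _.
have -> : (j.*2.+1%:R *: (xs j * as_ j)) vac = j.*2.+1%:R *: xs j (as_ j vac) by [].
by rewrite lower_vacuum endo0 scaler0.
Qed.

Lemma osc_H_vacuum : h vac = 0.
Proof.
rewrite /osc_H; set s := \sum_(j < l) _; set k := l.+1%:R * _ * _ / _.
have -> : (- s - k *: (as_ 0%N * as_ 0%N)) vac =
  - s vac - k *: as_ 0%N (as_ 0%N vac) by [].
rewrite lower_vacuum endo0 scaler0 subr0 endo_sumE big1 ?oppr0 // => j _.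
have -> : ((l.+2 + j)%:R *: (xs j * as_ j.+1)) vac =
  (l.+2 + j)%:R *: xs j (as_ j.+1 vac) by [].
by rewrite lower_vacuum endo0 scaler0.
Qed.

Lemma fock_D_vacuum : fock_rho (GenD l) vac = delta *: vac.
Proof.
have -> : fock_rho (GenD l) vac = d vac + 2 *: x 0%N (- a 0%N vac) by [].
by rewrite osc_D_vacuum lower_vacuum oppr0 endo0 scaler0 addr0.
Qed.

Lemma fock_H_vacuum : fock_rho (GenH l) vac = 0.
Proof.
have -> : fock_rho (GenH l) vac =
  h vac - a 0%N (d vac) + x 0%N (z (- a 0%N vac)) by [].
rewrite osc_H_vacuum osc_D_vacuum endoZ lower_vacuum scaler0 oppr0.
by rewrite !endo0 !addr0.
Qed.

Lemma ind_PE n u : P n u =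
  \sum_(i < N.+1 - n) 'C(N - n, i)%:R *: (z ^+ i) (p (n + i) u).
Proof. exact: endo_sumE. Qed.

Lemma pow_lower_raise i j u : (z ^+ i) (x j.+1 u) = x j.+1 ((z ^+ i) u).
Proof.
have zx : lie (x j.+1) (z ^+ i) = 0.
  by rewrite lieXr0 // lieNr lieC lie_lower_raise !oppr0.
by have /(congr1 (fun f : endo K _ => f u)) := lie_eq0 zx.
Qed.

(** Terms with n + i <= l end in an annihilator. In the others i > 0, and z^i commutes with the
    creator and kills the vacuum. *)
Lemma fock_P_vacuum n : (n <= l)%N -> P n vac = 0.
Proof.
move=> le_nl; rewrite ind_PE big1 // => i _; rewrite /osc_P.
case: leqP => [_|lt_l].
  have -> : ((mu * cga_I K l (n + i)) *: as_ (l - (n + i))%N) vac =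
    (mu * cga_I K l (n + i)) *: as_ (l - (n + i))%N vac by [].
  by rewrite lower_vacuum scaler0 endo0 scaler0.
rewrite pow_lower_raise lower_pow_vacuum ?endo0 ?scaler0 //.
by rewrite lt0n; apply: contraL lt_l => /eqP ->; rewrite addn0 -leqNgt.
Qed.

(** Only the term i = 0, the creator at position 1, contributes: in every other term a creator at a
    position at least 2 can be moved to the front, and [coef1] kills it. *)
Lemma coef1_P k u : coef1 k.+1 (P l.+1 u) = k.+1%:R * coef1 k u.
Proof.
rewrite ind_PE -addnn subSS -addSn addnK big_ord_recl /= bin0 scale1r addn0.
rewrite {1}/osc_P ltnn subnn.
have coef1D f g : coef1 k.+1 (f + g) = coef1 k.+1 f + coef1 k.+1 g :> K by [].
have coef1Z c f : coef1 k.+1 (c *: f) = c * coef1 k.+1 f :> K by [].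
rewrite coef1D -[RHS]addr0 -coef1_raise1; congr (_ + _).
rewrite (big_morph (coef1 k.+1) coef1D (erefl : coef1 k.+1 0 = 0 :> K)).
rewrite big1 // => i _; rewrite coef1Z /osc_P addSn leqNgt ltnS leq_addr /=.
by rewrite pow_lower_raise coef1_raise0 ?mulr0 // subSS addKn.
Qed.

Let X : endo K (nat -> nat) :=
  (alpha_ell K l * mu) *: fock_rho (GenC l) - P l.+1 ^+ 2.

Lemma coef1_X k u : coef1 k.+2 (X u) = - (k.+2 * k.+1)%:R * coef1 k u.
Proof.
transitivity (alpha_ell K l * mu * coef1 k.+2 (x 0%N u)
  - coef1 k.+2 (P l.+1 (P l.+1 u))) => //.
by rewrite coef1_raise0 // mulr0 sub0r !coef1_P natrM mulNr mulrA.
Qed.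

Lemma X_vacuum_neq0 q : (X ^+ q) vac != 0.
Proof.
have: coef1 (2 * q) ((X ^+ q) vac) != 0.
  elim: q => [|q IHq]; last first.
    rewrite exprS mulnS coef1_X mulf_eq0 oppr_eq0 pnatr_eq0 negb_or.
    exact/andP.
  by rewrite /coef1 /= /vacuum asboolT ?oner_neq0.
by apply: contra_neq => ->.
Qed.

Let rho_br (u v : cga K l) :
  lin_rho fock_rho u * lin_rho fock_rho v - lin_rho fock_rho v * lin_rho fock_rho u
  = lin_rho fock_rho (cga_bracket u v).
Proof.
apply: lin_rho_cga_bracket.
- exact: lie_lower_raise.
- exact: lie_lower_lower.
- exact: lie_raise_raise.
Qed.

Let lift : Ucga K l -> endo K (nat -> nat) := env_lift fock_rho.

Let lift_inj (u : cga K l) : lift (Uinj u) = lin_rho fock_rho u.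
Proof. exact: (env_lift_inj rho_br). Qed.

(** The vacuum is a highest weight vector of weight (delta, mu), so acting on it respects the
    relations that define the Verma module. *)
Let lift_verma_rel u : verma_rel delta mu u -> lift u vac = 0.
Proof.
have liftA c : lift c%:A vac = c *: vac.
  by rewrite /lift (env_liftZ rho_br) (env_lift1 rho_br).
have liftB f g : lift (f - g) vac = lift f vac - lift g vac.
  by rewrite /lift (env_liftB rho_br).
case=> [[v v_plus ->]|->|->].
- move: v v_plus; apply: cga_plus_ind => [|j le_jl|c v w v0 w0].
  + by rewrite lift_inj lin_rho_basis fock_H_vacuum.
  + by rewrite lift_inj lin_rho_P fock_P_vacuum.
  + move: v0 w0; rewrite !lift_inj linearP /= => v0 w0.
    by rewrite v0 w0 scaler0 addr0.
- by rewrite liftB liftA lift_inj lin_rho_basis fock_D_vacuum subrr.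
- by rewrite liftB liftA lift_inj lin_rho_basis subrr.
Qed.

Lemma verma_pow_neq0 (q : nat) :
  ((alpha_ell K l * mu) *: Uinj (vC K l) - Uinj (vP K l l.+1) ^+ 2) ^+ q
    *: hwvec l delta mu != 0.
Proof.
set Y : Ucga K l := _ - _.
have liftY : lift Y = X.
  rewrite /lift (env_liftB rho_br) (env_liftZ rho_br) (env_liftX rho_br).
  rewrite -/lift !lift_inj.
  by rewrite lin_rho_basis lin_rho_P.
apply/eqP => Yq0; suff: lift (Y ^+ q) vac == 0.
  by rewrite /lift (env_liftX rho_br) -/lift liftY (negPf (X_vacuum_neq0 q)).
(* Vanishing in the quotient puts [Y ^+ q] in the left ideal of the highest weight relations, and
   all of that ideal kills the vacuum. *)
have: lideal_gen (verma_rel delta mu) (Y ^+ q).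
  rewrite -[Y ^+ q]subr0; apply/lquot_piP.
  have <- : Y ^+ q *: hwvec l delta mu = lquot_pi (verma_rel delta mu) (Y ^+ q).
    by apply: etrans (lquot_scale_pi _ _ _) _; rewrite mulr1.
  by rewrite Yq0 lquot_pi0.
elim=> [f s rel_s||f g _ /eqP f0 _ /eqP g0].
- have -> : lift (f * s) vac = lift f (lift s vac) by rewrite /lift (env_liftM rho_br).
  by rewrite lift_verma_rel // endo0.
- by rewrite -(subrr (0 : Ucga K l)) /lift (env_liftB rho_br) subrr.
- have -> : lift (f - g) vac = lift f vac - lift g vac.
    by rewrite /lift (env_liftB rho_br).
  by rewrite f0 g0 subrr.
Qed.

End VermaNonvanishing.

(** * Singular vectors *)

Section HighestWeight.
Variables (K : numFieldType) (A : algType K) (V : lmodType A).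
Variables (l : nat) (delta mu alpha inv : K).
Variables (C D H M : A) (P : nat -> A).
Local Notation Q := (P l.+1).
Hypothesis lie_MC : lie M C = 0.
Hypothesis lie_MQ : lie M Q = 0.
Hypothesis lie_DC : lie D C = - (2 *: C).
Hypothesis lie_DQ : lie D Q = - Q.
Hypothesis lie_HC : lie H C = - D.
Hypothesis lie_HQ : lie H Q = - (l.+1%:R *: P l).
Hypothesis lie_PC : forall k, (k <= l)%N ->
  lie (P k) C = - ((l.*2.+1 - k)%:R *: P k.+1).
Hypothesis lie_PQ : forall k, (k <= l)%N ->
  lie (P k) Q = if k == l then inv *: M else 0.
Hypothesis alpha_inv : l.+1%:R * alpha = - 2 * inv.

Let X := (alpha * mu) *: C - Q ^+ 2.

Let lieQ2 f : lie f (Q ^+ 2) = lie f Q * Q + Q * lie f Q.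
Proof. by rewrite expr2 lieMr. Qed.

Lemma lie_MX : lie M X = 0.
Proof.
rewrite lieDr lieNr lieZr lieQ2 lie_MC lie_MQ.
by rewrite scaler0 mul0r mulr0 addr0 subrr.
Qed.

Lemma lie_DX : lie D X = - (2 *: X).
Proof.
rewrite lieDr lieNr lieZr lieQ2 lie_DC lie_DQ mulNr mulrN -expr2 scalerDr.
by rewrite -opprD opprK !scalerN !scalerA mulrC opprB addrC scaler_nat mulr2n.
Qed.

Lemma lie_PX k : (k < l)%N ->
  lie (P k) X = - ((alpha * mu * (l.*2.+1 - k)%:R) *: P k.+1).
Proof.
move=> lt_k; rewrite lieDr lieNr lieZr lieQ2 lie_PC ?(ltnW lt_k) //.
rewrite lie_PQ ?(ltnW lt_k) // (ltn_eqF lt_k) mul0r mulr0 addr0 subr0.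
by rewrite scalerN scalerA.
Qed.

(** Here the value of alpha matters: by [alpha_inv] the contribution of C and the two of M combine
    into M - mu, which kills X^q v. *)
Lemma lie_PlX : lie (P l) X = (l.+1%:R * alpha) *: (Q * (M - mu%:A)).
Proof.
have QM : M * Q = Q * M := lie_eq0 lie_MQ.
rewrite lieDr lieNr lieZr lieQ2 lie_PC // lie_PQ // eqxx.
rewrite -scalerAl -scalerAr QM -scalerDl mulrBr -scalerAr mulr1 scalerBr.
rewrite scalerN !scalerA [LHS]addrC -[X in X - _]scaleNr; congr (_ *: _ - _ *: _).
  by rewrite alpha_inv; ring.
by rewrite -addnn -addSn addnK; ring.
Qed.

(** P_l is moved to the right of Q, where it will kill X^q v; the reordering produces the term in
    M. *)
Lemma lie_HX : lie H X =
  - ((alpha * mu) *: D) + l.+1%:R *: (2 *: (Q * P l) + inv *: M).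
Proof.
have QPl : P l * Q = Q * P l + inv *: M.
  by have := lie_PQ (leqnn l); rewrite eqxx => <-; rewrite addrC subrK.
rewrite lieDr lieNr lieZr lieQ2 lie_HC lie_HQ mulNr mulrN -opprD opprK.
rewrite -scalerAl -scalerAr -scalerDr QPl scalerN; congr (_ + _ *: _).
by rewrite addrAC scaler_nat mulr2n.
Qed.

Variable v : V.
Hypothesis Mv : M *: v = mu%:A *: v.
Hypothesis Dv : D *: v = delta%:A *: v.
Hypothesis Hv : H *: v = 0.
Hypothesis Pv : forall k, (k <= l)%N -> P k *: v = 0.

Let scale_alg (c : K) (f : A) (w : V) : (c *: f) *: w = c%:A *: (f *: w).
Proof. by rewrite scalerA mulr_algl. Qed.

Let scale_algC (c : K) (f : A) (w : V) : f *: (c%:A *: w) = c%:A *: (f *: w).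
Proof. by rewrite !scalerA mulr_algl mulr_algr. Qed.

Let scale_lie f g (w : V) : f *: (g *: w) = g *: (f *: w) + lie f g *: w.
Proof. by rewrite !scalerA -scalerDl /lie addrC subrK. Qed.

Let XS q : X ^+ q.+1 *: v = X *: (X ^+ q *: v).
Proof. by rewrite exprS scalerA. Qed.

Lemma M_pow q : M *: (X ^+ q *: v) = mu%:A *: (X ^+ q *: v).
Proof.
elim: q => [|q IHq]; first by rewrite expr0 scale1r.
by rewrite XS scale_lie lie_MX IHq scale0r addr0 scale_algC.
Qed.

Lemma D_pow q : D *: (X ^+ q *: v) = (delta - (2 * q)%:R)%:A *: (X ^+ q *: v).
Proof.
elim: q => [|q IHq]; first by rewrite expr0 scale1r muln0 subr0.
rewrite XS scale_lie lie_DX -scaleNr IHq scale_algC (scale_alg (- 2)).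
rewrite -scalerDl -scalerDl.
by congr (_%:A *: _); rewrite mulnS natrD; ring.
Qed.

(** The induction on [q] treats all k <= l at once, because [P_k, X] involves P_{k+1}; at k = l the
    factor M - mu takes over. *)
Lemma P_pow q k : (k <= l)%N -> P k *: (X ^+ q *: v) = 0.
Proof.
elim: q k => [|q IHq] k le_k; first by rewrite expr0 scale1r Pv.
rewrite XS scale_lie IHq // scaler0 add0r.
move: le_k; rewrite leq_eqVlt => /predU1P[->|lt_k].
  by rewrite lie_PlX scale_alg -(scalerA Q) scalerBl M_pow subrr !scaler0.
by rewrite lie_PX // -scaleNr scale_alg IHq ?scaler0.
Qed.

(** On X^j v the bracket [H, X] is the scalar - alpha mu (delta - 2j + (l+1)^2 / 2); the sum over j
    < q is the stated coefficient. *)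
Lemma H_pow q : H *: (X ^+ q *: v) =
  (q%:R * alpha * mu / 2 * - (2 * delta - 2 * (q%:R - 1) + l.+1%:R ^+ 2))%:A
    *: (X ^+ q.-1 *: v).
Proof.
elim: q => [|q IHq]; first by rewrite expr0 scale1r Hv !mul0r !scale0r.
rewrite XS scale_lie IHq scale_algC -XS lie_HX.
(* At q = 0 the exponents differ, but both sides carry the factor q. *)
have -> c : (q%:R * alpha * mu / 2 * c)%:A *: (X ^+ q.-1.+1 *: v) =
    (q%:R * alpha * mu / 2 * c)%:A *: (X ^+ q *: v).
  by case: q {IHq} => // ; rewrite !mul0r !scale0r.
set w := X ^+ q *: v; have Dw : D *: w = _ := D_pow q.
have Mw : M *: w = _ := M_pow q; have Pw : P l *: w = 0 := P_pow q (leqnn l).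
rewrite [(- _ + _) *: w]scalerDl -scaleNr (scale_alg (- _) D) Dw (scale_alg _ (_ + _)).
rewrite [(_ *: (Q * P l) + _) *: w]scalerDl (scale_alg 2) (scale_alg inv).
rewrite -(scalerA Q) Pw Mw !scaler0 add0r /=.
have scale_algA c e (u : V) : c%:A *: (e%:A *: u) = (c * e)%:A *: u.
  by rewrite scalerA mulr_algl scalerA.
rewrite !scale_algA -!scalerDl; congr (_%:A *: _).
have -> : inv = - (l.+1%:R * alpha / 2) by rewrite alpha_inv; field.
by rewrite natrM -[q.+1%:R]natr1; field.
Qed.

End HighestWeight.

(** * Singular vectors in an arbitrary highest weight module *)

Section HighestWeightModules.
Variables (K : numFieldType) (l : nat).

Lemma cga_bracketE (b b' : cga_gen l) :
  cga_bracket (cga_basis K b) (cga_basis K b') = cga_bracket_basis K b b'.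
Proof.
rewrite /cga_bracket (bigD1 b) //= [X in _ + X]big1 => [|c /negPf cb].
  rewrite addr0 (bigD1 b') //= [X in _ + X]big1 => [|c /negPf cb].
    by rewrite addr0 !ffunE !eqxx mulr1 scale1r.
  by rewrite !ffunE cb mulr0 scale0r.
by rewrite big1 // => c' _; rewrite !ffunE cb mul0r scale0r.
Qed.

Variables (A : algType K) (inj : cga K l -> A).
Hypothesis inj_lin : linear inj.
Hypothesis lie_inj : forall u v, lie (inj u) (inj v) = inj (cga_bracket u v).

Let inj0 : inj 0 = 0.
Proof. by have := inj_lin (-1) 0 0; rewrite scaler0 addr0 scaleN1r addNr. Qed.

Let injZ c u : inj (c *: u) = c *: inj u.
Proof. by have := inj_lin c u 0; rewrite inj0 !addr0. Qed.

Let injN u : inj (- u) = - inj u.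
Proof. by rewrite -scaleN1r injZ scaleN1r. Qed.

Lemma highest_weight_singular (V : lmodType A) (delta mu : K) (v : V) q :
  (forall u, u \in cga_plus K l -> inj u *: v = 0) ->
  inj (vD K l) *: v = delta%:A *: v -> inj (vM K l) *: v = mu%:A *: v ->
  2 * delta - 2 * (q%:R - 1) + l.+1%:R ^+ 2 = 0 ->
  let w := ((alpha_ell K l * mu) *: inj (vC K l) - inj (vP K l l.+1) ^+ 2) ^+ q *: v in
  inj (vD K l) *: w = (delta - (2 * q)%:R)%:A *: w /\
  forall u, u \in cga_plus K l -> inj u *: w = 0.
Proof.
move=> hw0 Dv Mv delta_q w; pose P n := inj (vP K l n).
have lt_l1 : (l.+1 < l.*2.+2)%N by rewrite !ltnS -addnn leq_addr.
have lt_k k : (k <= l)%N -> (k < l.*2.+2)%N.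
  by move=> le_k; rewrite (leq_ltn_trans le_k) // ltnS -addnn leqW ?leq_addr.
have two_ell : 2 * ell K l = l.*2.+1%:R.
  by rewrite /ell -muln2 -(addn1 (l * 2)) natrD natrM; field.
have rel (b b' : cga_gen l) : lie (inj (cga_basis K b)) (inj (cga_basis K b')) =
  inj (cga_bracket_basis K b b') by rewrite lie_inj cga_bracketE.
have MC : lie (inj (vM K l)) (inj (vC K l)) = 0 by rewrite rel /= inj0.
have MQ : lie (inj (vM K l)) (P l.+1) = 0 by rewrite /P (vP_basis _ lt_l1) rel /= inj0.
have DC : lie (inj (vD K l)) (inj (vC K l)) = - (2 *: inj (vC K l)).
  by rewrite rel /= injN injZ.
have DQ : lie (inj (vD K l)) (P l.+1) = - P l.+1.
  rewrite {1}/P (vP_basis _ lt_l1) rel /= injZ mulrBr two_ell -scaleN1r.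
  by congr (_ *: _); rewrite -muln2; ring.
have HC : lie (inj (vH K l)) (inj (vC K l)) = - inj (vD K l).
  by rewrite rel /= injN.
have HQ : lie (inj (vH K l)) (P l.+1) = - (l.+1%:R *: P l).
  by rewrite {1}/P (vP_basis _ lt_l1) rel /= injN injZ.
have PC k : (k <= l)%N ->
    lie (P k) (inj (vC K l)) = - ((l.*2.+1 - k)%:R *: P k.+1).
  move=> le_k; rewrite {1}/P (vP_basis _ (lt_k _ le_k)) rel /= injN injZ.
  by rewrite two_ell natrB // -ltnS lt_k.
have PQ k : (k <= l)%N ->
    lie (P k) (P l.+1) = if k == l then cga_I K l l *: inj (vM K l) else 0.
  move=> le_k; rewrite /P (vP_basis _ (lt_k _ le_k)) (vP_basis _ lt_l1) rel /=.
  rewrite -addnn -addnS eqn_add2r; case: eqP => [->|_]; last exact: inj0.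
  by rewrite injZ.
(* The sign exponent l + (l + 1) is odd, so I_l = - l! (l+1)!, which matches alpha = 2 (l!)^2. *)
have alphaI : l.+1%:R * alpha_ell K l = - 2 * cga_I K l l.
  have e : (l.*2.+1 - l = l.+1)%N by rewrite -addnn -addnS addKn.
  have sgn : (-1) ^+ (l + l.+1) = -1 :> K.
    by rewrite addnS addnn -signr_odd /= odd_double.
  by rewrite /alpha_ell /cga_I e sgn factS natrM; ring.
have H_plus : vH K l \in cga_plus K l by rewrite memv_span ?mem_head.
have P_plus k : (k <= l)%N -> vP K l k \in cga_plus K l.
  by move=> le_k; rewrite memv_span // inE map_f ?orbT // mem_iota.
have Hv := hw0 _ H_plus; have Pv k le_k := hw0 _ (P_plus k le_k).
split; first exact: (D_pow _ _ DC DQ Dv).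
apply: cga_plus_ind => [|j le_j|c u u' u0 u'0].
- rewrite /w (H_pow MC MQ DC DQ HC HQ PC PQ alphaI Mv Dv Hv Pv) delta_q.
  by rewrite oppr0 mulr0 !scale0r.
- exact: (P_pow MC MQ PC PQ alphaI Mv Pv).
- by rewrite inj_lin scalerDl -mulr_algl -scalerA u0 u'0 scaler0 addr0.
Qed.

End HighestWeightModules.

(** * Application to the Verma module *)

Section SingularVector.
Variables (K : numFieldType) (l : nat).

Fact tensor_inj_linear : linear (@tensor_inj K (cga_gen l)).
Proof.
move=> c u v; rewrite /tensor_inj scaler_sumr -big_split; apply: eq_bigr => b _.
rewrite !ffunE raddfD; congr (_ + _); apply/malgP => k.
by rewrite [RHS]mcoeffZ !mcoeffU mulrnAr.
Qed.

Fact Uinj_linear : linear (@Uinj K l).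
Proof.
move=> c u v; apply: etrans (congr1 (env_pi _) (tensor_inj_linear c u v)) _.
apply: etrans (env_piD _ _ _) _; apply: (congr1 (fun s => s + _)).
exact/esym/env_scale_pi.
Qed.

Lemma hwvec_scale (delta mu : K) (u : Ucga K l) :
  verma_rel delta mu u -> u *: hwvec l delta mu = 0.
Proof.
move=> rel_u; apply: etrans (lquot_scale_pi _ _ _) _; rewrite mulr1.
rewrite -(lquot_pi0 (verma_rel delta mu)); apply/lquot_piP.
by rewrite subr0 -[u]mul1r; apply: lideal_gen_base.
Qed.

Lemma singular_vector_pow (delta mu : K) q : (0 < q)%N ->
  2 * delta - 2 * (q%:R - 1) + l.+1%:R ^+ 2 = 0 ->
  singular_vector (2 * q)
    (((alpha_ell K l * mu) *: Uinj (vC K l) - Uinj (vP K l l.+1) ^+ 2) ^+ q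
       *: hwvec l delta mu).
Proof.
move=> q_gt0 delta_q; set v := hwvec l delta mu.
have hw (u : Ucga K l) c : verma_rel delta mu (u - c%:A) -> u *: v = c%:A *: v.
  by move/hwvec_scale/eqP; rewrite scalerBl subr_eq0 => /eqP.
have hw0 u : u \in cga_plus K l -> Uinj u *: v = 0.
  by move=> u_plus; apply: hwvec_scale; constructor 1; exists u.
have Dv : Uinj (vD K l) *: v = delta%:A *: v by apply: hw; constructor 2.
have Mv : Uinj (vM K l) *: v = mu%:A *: v by apply: hw; constructor 3.
have [Dw w_plus] := highest_weight_singular Uinj_linear
  (@env_inj_bracket _ _ (@cga_bracket K l)) hw0 Dv Mv delta_q.
split; [by rewrite muln_gt0|exact: verma_pow_neq0|exact: Dw|exact: w_plus].
Qed.

End SingularVector.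

Unset Implicit Arguments.

Theorem theorem1 (R : realType) (l : nat) (delta mu : R) (q : nat) :
  (0 < q)%N ->
  2 * delta - 2 * (q%:R - 1) + (ell R l + 2^-1) ^+ 2 = 0 ->
  let C := Uinj (vC R[i] l) in
  let P := Uinj (vP R[i] l l.+1) in
  singular_vector (2 * q)
    (((alpha_ell R[i] l * mu%:C) *: C - P ^+ 2) ^+ q
       *: hwvec l delta%:C mu%:C).
Proof.
move=> q_gt0 delta_q; apply: singular_vector_pow => //.
(* As ell = l + 1/2, the squared quantity is l + 1; the real equation is then carried over to the
   complex numbers. *)
have <- : (ell R l + 2^-1)%:C = l.+1%:R :> R[i].
  by rewrite -(rmorph_nat (real_complex R)); congr (_%:C); rewrite /ell -natr1; field.
have := congr1 (real_complex R) delta_q.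
by rewrite rmorph0 rmorphD rmorphB rmorphXn !rmorphM rmorphB rmorph1 !rmorph_nat.
Qed.
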